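(* There is no formula of $\mathrm{HCTL}^+$ which is logically equivalent to $\mathsf{E}\mathsf{F}^\infty p$, where $T,v,\vec u\models \mathsf{E}\mathsf{F}^\infty p$ iff there is a path $\pi$ starting from $v$ that has infinitely many nodes labelled by $p$.
   Context: Models are rooted trees (finite or infinite), edges directed from parents to children, nodes labelled with sets of atomic propositions; a path from $v$ is a maximal downward sequence of nodes starting at $v$. For $k\ge1$, formulas of $\mathrm{HCTL}^*_k$ (variables $x_1,\dots,x_k$): state formulas $\varphi ::= p \mid \neg\varphi \mid \varphi\lor\varphi \mid \varphi\land\varphi \mid \mathsf{E}\psi \mid \mathsf{A}\psi \mid {\downarrow}x_i\,\varphi \mid x_i \mid @_{x_i}\varphi \mid \mathit{root} \mid @_{\mathit{root}}\varphi$; path formulas $\psi ::= \varphi \mid \neg\psi \mid \psi\lor\psi\mid\psi\land\psi\mid \mathsf{X}\psi \mid \psi\,\mathsf{U}\,\psi$. State formulas are evaluated at tree $T$, node $v$, assignment $\vec u=(u_1,\dots,u_k)$: $p$ holds if $p$ labels $v$; $\mathsf{E}\psi$/$\mathsf{A}\psi$: some/every path from $v$ satisfies $\psi$ at position 0; ${\downarrow}x_i\varphi$: $\varphi$ holds at $v$ with $u_i$ replaced by $v$; $x_i$: $v=u_i$; $@_{x_i}\varphi$: $\varphi$ holds at $u_i$; $\mathit{root}$: $v$ is the root; $@_{\mathit{root}}\varphi$: $\varphi$ holds at the root. Path formulas at path $\pi$, position $i$: a state formula holds if it holds at $\pi(i)$; $\mathsf X\psi$: $\psi$ at $i+1$;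 $\psi_1\mathsf U\psi_2$: some $j\ge i$ has $\psi_2$ and all $l\in[i,j)$ have $\psi_1$. $\mathrm{HCTL}^+_k$: path formulas are Boolean combinations of $\mathsf X\varphi$ and $\varphi_1\mathsf U\varphi_2$ with state formulas $\varphi,\varphi_1,\varphi_2$. $\mathrm{HCTL}^+=\bigcup_{k\ge1}\mathrm{HCTL}^+_k$. Two state formulas are equivalent if they hold at exactly the same (tree, node, assignment) triples. *)

(* Defs.v *)
From Stdlib Require Import Relation_Operators.
From mathcomp Require Import all_boot.
From mathcomp Require Import classical_sets cardinality.

Set Implicit Arguments.
Unset Strict Implicit.
Unset Printing Implicit Defensive.

(* Branching is unrestricted: a node may have any number of children,
   including none. *)
Record tree (AP : Type) : Type := Tree {
  node :> Type;
  root : node;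
  edge : node -> node -> Prop;  (* [edge v w]: v is the parent of w *)
  label : node -> set AP;
  root_no_parent : forall v, ~ edge v root;
  parent_unique : forall v v' w, edge v w -> edge v' w -> v = v';
  root_reaches : forall v, clos_refl_trans node edge root v
}.
Arguments root {AP} t.

(* A finite or infinite sequence of nodes is a function to [option T] that
   stays [None] after the last node. Maximality is the last conjunct: the
   sequence ends only at a leaf. *)
Definition path_from (AP : Type) (T : tree AP) (v : T) (pi : nat -> option T)
    : Prop :=
  [/\ pi 0 = Some v,
      forall i, pi i = None -> pi i.+1 = None,
      forall i w w', pi i = Some w -> pi i.+1 = Some w' -> edge w w'
    & forall i w, pi i = Some w -> pi i.+1 = None -> forall w', ~ edge w w'].

(* The variables x_1, ..., x_k are indexed by ['I_k]. *)
Inductive sform (AP : Type) (k : nat) : Type :=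
  | SAtom of AP
  | SNot of sform AP k
  | SOr of sform AP k & sform AP k
  | SAnd of sform AP k & sform AP k
  | SE of pform AP k
  | SA of pform AP k
  | SBind of 'I_k & sform AP k   (* down-arrow x_i *)
  | SVar of 'I_k
  | SAt of 'I_k & sform AP k     (* @_{x_i} *)
  | SRoot
  | SAtRoot of sform AP k        (* @_{root} *)
with pform (AP : Type) (k : nat) : Type :=
  | PState of sform AP k
  | PNot of pform AP k
  | POr of pform AP k & pform AP k
  | PAnd of pform AP k & pform AP k
  | PX of pform AP k
  | PU of pform AP k & pform AP k.

Arguments SRoot {AP k}.
Arguments SVar {AP k} _.
Arguments SAtom {AP k} _.

(* HCTL^+_k inside HCTL^*_k. A state formula is a path formula only as a
   direct argument of X or U. *)
Fixpoint splus (AP : Type) (k : nat) (phi : sform AP k) : bool :=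
  match phi with
  | SAtom _ | SVar _ | SRoot => true
  | SNot phi1 | SBind _ phi1 | SAt _ phi1 | SAtRoot phi1 => splus phi1
  | SOr phi1 phi2 | SAnd phi1 phi2 => splus phi1 && splus phi2
  | SE psi | SA psi => pplus psi
  end
with pplus (AP : Type) (k : nat) (psi : pform AP k) : bool :=
  match psi with
  | PX (PState phi) => splus phi
  | PU (PState phi1) (PState phi2) => splus phi1 && splus phi2
  | PNot psi1 => pplus psi1
  | POr psi1 psi2 | PAnd psi1 psi2 => pplus psi1 && pplus psi2
  | PState _ | PX _ | PU _ _ => false
  end.

Definition assign (AP : Type) (k : nat) (T : tree AP) (u : 'I_k -> T)
    (i : 'I_k) (v : T) : 'I_k -> T :=
  fun j => if j == i then v else u j.

(* [psat psi u pi i] is meaningful only for positions [i] on the path, i.e.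
   [pi i <> None]. X and U check this explicitly for the positions they move
   to; otherwise a negated path formula would hold past the end of a finite
   path. *)
Fixpoint ssat (AP : Type) (k : nat) (T : tree AP) (phi : sform AP k)
    (v : T) (u : 'I_k -> T) : Prop :=
  match phi with
  | SAtom p => label v p
  | SNot phi1 => ~ ssat phi1 v u
  | SOr phi1 phi2 => ssat phi1 v u \/ ssat phi2 v u
  | SAnd phi1 phi2 => ssat phi1 v u /\ ssat phi2 v u
  | SE psi => exists pi, path_from v pi /\ psat psi u pi 0
  | SA psi => forall pi, path_from v pi -> psat psi u pi 0
  | SBind i phi1 => ssat phi1 v (assign u i v)
  | SVar i => v = u i
  | SAt i phi1 => ssat phi1 (u i) u
  | SRoot => v = root T
  | SAtRoot phi1 => ssat phi1 (root T) u
  end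
with psat (AP : Type) (k : nat) (T : tree AP) (psi : pform AP k)
    (u : 'I_k -> T) (pi : nat -> option T) (i : nat) : Prop :=
  match psi with
  | PState phi => exists v, pi i = Some v /\ ssat phi v u
  | PNot psi1 => ~ psat psi1 u pi i
  | POr psi1 psi2 => psat psi1 u pi i \/ psat psi2 u pi i
  | PAnd psi1 psi2 => psat psi1 u pi i /\ psat psi2 u pi i
  | PX psi1 => pi i.+1 <> None /\ psat psi1 u pi i.+1
  | PU psi1 psi2 => exists j,
      [/\ i <= j, pi j <> None, psat psi2 u pi j
        & forall l, i <= l < j -> psat psi1 u pi l]
  end.

(* The truth condition of E F^oo p; it does not depend on the assignment. *)
Definition EFinf (AP : Type) (p : AP) (T : tree AP) (v : T) : Prop :=
  exists pi : nat -> option T,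
    path_from v pi /\
    infinite_set [set w : T | (exists i, pi i = Some w) /\ label w p]%classic.

(* Main.v *)
(* Fix a formula of depth n. We build two unravellings of one transition system,
   a clock that counts down to the next visit to p and that may pause at any
   moment, such that in the first one p can be visited at most r times along a
   path, in the second one without limit. In both, successive visits to p are at
   least h steps apart.

   With r and h large, the two roots cannot be told apart. Configurations of nodes
   are compared by an Ehrenfeucht-Fraisse game: a position is a finite set of
   matched nodes closed under greatest common prefixes, and the words labelling
   matched segments must agree up to the n-round word game. A Boolean combination
   of X and U only sees, along a path, the set of pairs (type of the word read so
   far, current letter). This set is finite, so a path with infinitely many visits
   to p has exhausted it after finitely many visits; by pigeonhole these can be
   cut down to boundedly many, after which the path may pause forever halfway to
   the next visit without showing anything new. *)

From Stdlib Require Import Relation_Operators.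
Require Import Defs.
From mathcomp Require Import all_boot.
From mathcomp Require Import boolp classical_sets cardinality.
From mathcomp Require Import zify.

Set Implicit Arguments.
Unset Strict Implicit.
Unset Printing Implicit Defensive.

(** * Games on words *)

Section WordGame.
Variable S : Type.
Implicit Types (R : S -> S -> Prop) (x y z : seq S).

(** Ehrenfeucht-Fraisse game on ordered words: a chosen letter splits both words, and play goes on
    in the left and right pieces separately. With no round left emptiness is still compared; this
    later keeps a new matched node strictly below the next one. *)
Fixpoint word_game R n x x' : Prop :=
  if n is m.+1 then
    (forall y s z, x = y ++ s :: z -> exists y' s' z',
      [/\ x' = y' ++ s' :: z', word_game R m y y', R s s' & word_game R m z z'])
    /\ (forall y' s' z', x' = y' ++ s' :: z' -> exists y s z,
      [/\ x = y ++ s :: z, word_game R m y y', R s s' & word_game R m z z'])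
  else nilp x = nilp x'.

Lemma word_game_nilp R n x x' : word_game R n x x' -> nilp x = nilp x'.
Proof.
case: n => //= n [H1 H2].
case: x H1 H2 => [|s x] H1 H2; case: x' H1 H2 => [|s' x'] H1 H2 //.
  by have [[|? ?] [? [? []]]] := H2 [::] s' x' erefl.
by have [[|? ?] [? [? []]]] := H1 [::] s x erefl.
Qed.

Lemma word_gameS R n x x' : word_game R n.+1 x x' -> word_game R n x x'.
Proof.
elim: n x x' => [|n IH] x x' H; first exact: word_game_nilp H.
case: H => H1 H2; split=> [y s z|y' s' z'] e.
  have [y' [s' [z' [e' Hy Hs Hz]]]] := H1 _ _ _ e.
  by exists y', s', z'; split=> //; apply: IH.
have [y [s [z [e' Hy Hs Hz]]]] := H2 _ _ _ e.
by exists y, s, z; split=> //; apply: IH.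
Qed.

Lemma word_game_mono R1 R2 n x x' :
  (forall s s', R1 s s' -> R2 s s') -> word_game R1 n x x' -> word_game R2 n x x'.
Proof.
move=> R12; elim: n x x' => [|n IH] x x' //= [H1 H2].
split=> [y s z|y' s' z'] e.
  have [y' [s' [z' [e' Hy Hs Hz]]]] := H1 _ _ _ e.
  by exists y', s', z'; split; auto.
have [y [s [z [e' Hy Hs Hz]]]] := H2 _ _ _ e.
by exists y, s, z; split; auto.
Qed.

Lemma word_game_sym R n x x' :
  (forall s s', R s s' -> R s' s) -> word_game R n x x' -> word_game R n x' x.
Proof.
move=> Rsym; elim: n x x' => [|n IH] x x' //= [H1 H2].
split=> [y s z|y' s' z'] e.
  have [y' [s' [z' [e' Hy Hs Hz]]]] := H2 _ _ _ e.
  by exists y', s', z'; split; auto.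
have [y [s [z [e' Hy Hs Hz]]]] := H1 _ _ _ e.
by exists y, s, z; split; auto.
Qed.

Lemma word_game_nil R n : word_game R n [::] [::].
Proof. by case: n => //= n; split=> [] [|? ?] ? ?. Qed.

Lemma word_game1 R n s s' : R s s' -> word_game R n [:: s] [:: s'].
Proof.
case: n => //= n Hs; split.
  move=> [|? [|? ?]] t [|? ?] //= [<-].
  by exists [::], s', [::]; split=> //; apply: word_game_nil.
move=> [|? [|? ?]] t [|? ?] //= [<-].
by exists [::], s, [::]; split=> //; apply: word_game_nil.
Qed.

Lemma cat_split (x y u v : seq S) s : x ++ y = u ++ s :: v ->
  (exists2 v1, x = u ++ s :: v1 & v = v1 ++ y) \/
  (exists2 u1, y = u1 ++ s :: v & u = x ++ u1).
Proof.
elim: x u => [|a x IH] [|b u] /=.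
- by move=> e; right; exists [::].
- by move=> e; right; exists (b :: u).
- by case=> -> <-; left; exists x.
case=> -> /IH [[v1 -> ->]|[u1 -> ->]]; first by left; exists v1.
by right; exists u1.
Qed.

(** A letter chosen in a concatenation lies in one of the two factors and is answered there; the
    untouched factor is glued to the adjacent remaining piece, which induction handles with one
    round less. *)
Lemma word_game_cat R n x x' y y' :
  word_game R n x x' -> word_game R n y y' -> word_game R n (x ++ y) (x' ++ y').
Proof.
elim: n x x' y y' => [|n IH] x x' y y' Hx Hy.
  by move: Hx Hy => /=; rewrite /nilp !size_cat !addn_eq0 => -> ->.
have Hx1 := word_gameS Hx; have Hy1 := word_gameS Hy.
case: Hx Hy => [x1 x2] [y1 y2]; split=> u s v /cat_split [[v1 e ->]|[u1 e ->]].
- have [u' [s' [v' [-> Hu Hs Hv]]]] := x1 _ _ _ e.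
  by exists u', s', (v' ++ y'); split; rewrite -?catA //; apply: IH.
- have [u' [s' [v' [-> Hu Hs Hv]]]] := y1 _ _ _ e.
  by exists (x' ++ u'), s', v'; split; rewrite ?catA //; apply: IH.
- have [u' [s' [v' [-> Hu Hs Hv]]]] := x2 _ _ _ e.
  by exists u', s', (v' ++ y); split; rewrite -?catA //; apply: IH.
have [u' [s' [v' [-> Hu Hs Hv]]]] := y2 _ _ _ e.
by exists (x ++ u'), s', v'; split; rewrite ?catA //; apply: IH.
Qed.

End WordGame.

(** * Greatest common prefixes *)

Section Lcp.
Variable L : eqType.
Implicit Types a b c z e : seq L.

Fixpoint lcp a b : seq L :=
  match a, b with
  | x :: a1, y :: b1 => if x == y then x :: lcp a1 b1 else [::]
  | _, _ => [::]
  end.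

Lemma prefix_lcp c a b : prefix c (lcp a b) = prefix c a && prefix c b.
Proof.
elim: a b c => [|x a IH] [|y b] [|z c] //=.
- by rewrite andbF.
- by rewrite prefix0s.
case: (eqVneq x y) => [<-|nxy] /=.
  by rewrite IH; case: (z == x).
by case: (eqVneq z x) => [->|] //=; rewrite (negPf nxy) andbF.
Qed.

Lemma prefix_anti a b : prefix a b -> prefix b a -> a = b.
Proof.
move=> ab ba; apply/eqP; move: ab; rewrite prefixE take_oversize; last exact: size_prefix.
by rewrite eq_sym.
Qed.

Lemma lcpC a b : lcp a b = lcp b a.
Proof.
by apply: prefix_anti; rewrite prefix_lcp andbC -prefix_lcp prefix_refl.
Qed.

Lemma lcp_prefixl a b : prefix (lcp a b) a.
Proof. by have := prefix_refl (lcp a b); rewrite prefix_lcp => /andP []. Qed.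

Lemma lcp_prefixr a b : prefix (lcp a b) b.
Proof. by rewrite lcpC lcp_prefixl. Qed.

Lemma lcp_idPl a b : prefix a b -> lcp a b = a.
Proof.
move=> ab; apply: prefix_anti; first exact: lcp_prefixl.
by rewrite prefix_lcp prefix_refl.
Qed.

Lemma prefix_comparable a b c : prefix a c -> prefix b c ->
  size a <= size b -> prefix a b.
Proof.
by rewrite !prefixE => /eqP ea /eqP eb ab; rewrite -eb take_takel // ea.
Qed.

(** The common part of [b] and [e] ends strictly before [z], so cutting [b] down to [z] does not
    move the branching point. *)
Lemma lcp_below z b e : prefix z b -> ~~ prefix z e -> lcp z e = lcp b e.
Proof.
move=> zb nze; apply: prefix_anti.
  by rewrite prefix_lcp lcp_prefixr (prefix_trans (lcp_prefixl _ _)).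
rewrite prefix_lcp lcp_prefixr andbT.
case: (leqP (size (lcp b e)) (size z)) => [|/ltnW] le.
  exact: prefix_comparable (lcp_prefixl _ _) zb le.
have := prefix_comparable zb (lcp_prefixl b e) le.
by move=> /prefix_trans /(_ (lcp_prefixr b e)); rewrite (negPf nze).
Qed.

End Lcp.

(** * Unravellings of a transition system *)

Section Unravelling.
Variables (S : eqType) (step : rel S) (nxt : S -> S).
Hypothesis step_nxt : forall s, step s (nxt s).

(* Nodes of the unravelling are arbitrary words, the letter [(s, i)] meaning
   "go to the i-th copy of s"; an illegal move is replaced by a move to [nxt]. *)
Notation unode := (seq (S * nat)).
Implicit Types (s : S) (a b c w z : unode).

Definition move s (l : S * nat) : S := if step s l.1 then l.1 else nxt s.

Definition state s0 w : S := foldl move s0 w.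

(** For [a] a prefix of [b]: the states read on the way from [a] (excluded) to [b] (included). With
    this half-open convention consecutive segments concatenate. *)
Definition segment s0 a b : seq S := drop (size a) (scanl move s0 b).

Lemma step_move s l : step s (move s l).
Proof. by rewrite /move; case: ifP. Qed.

Lemma state_rcons s0 w l : state s0 (rcons w l) = move (state s0 w) l.
Proof. by rewrite /state foldl_rcons. Qed.

Lemma segment_catE s0 a x : segment s0 a (a ++ x) = scanl move (state s0 a) x.
Proof. by rewrite /segment scanl_cat drop_size_cat // size_scanl. Qed.

Lemma size_segment s0 a b : size (segment s0 a b) = size b - size a.
Proof. by rewrite size_drop size_scanl. Qed.

Lemma segment_trans s0 a b c : prefix a b -> prefix b c ->
  segment s0 a c = segment s0 a b ++ segment s0 b c.
Proof.
move=> /prefixP [x ->] /prefixP [y ->].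
by rewrite !segment_catE -catA segment_catE scanl_cat /state foldl_cat.
Qed.

Lemma segment_refl s0 a : segment s0 a a = [::].
Proof. by rewrite -{2}(cats0 a) segment_catE. Qed.

Lemma segment_rcons s0 a b l : prefix a b ->
  segment s0 a (rcons b l) = rcons (segment s0 a b) (state s0 (rcons b l)).
Proof.
move=> ab; rewrite (segment_trans s0 ab) ?prefix_rcons //.
by rewrite -!cats1 segment_catE /= /state foldl_cat.
Qed.

Lemma segment_last s0 a b : prefix a b -> a != b ->
  exists y, segment s0 a b = rcons y (state s0 b).
Proof.
move=> /prefixP [x ->]; case/lastP: x => [|x l]; first by rewrite cats0 eqxx.
by move=> _; exists (segment s0 a (a ++ x)); rewrite -rcons_cat segment_rcons ?prefix_prefix.
Qed.

(** Links the two games: a letter chosen in a segment becomes a node of the tree between the two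
    ends. *)
Lemma segment_split s0 a b y s t : prefix a b -> segment s0 a b = y ++ s :: t ->
  exists z, [/\ prefix a z, prefix z b, segment s0 a z = rcons y s,
                state s0 z = s & segment s0 z b = t].
Proof.
move=> /prefixP [x ->]; rewrite segment_catE => e.
have sx : size x = (size y + (size t).+1)%N.
  by rewrite -(size_scanl move (state s0 a)) e size_cat.
have take_scanl k v r : scanl move v (take k r) = take k (scanl move v r).
  by elim: r k v => [|l r IH] [|k] v //=; rewrite IH.
have ez : segment s0 a (a ++ take (size y).+1 x) = rcons y s.
  by rewrite segment_catE take_scanl e -cat_rcons take_size_cat ?size_rcons.
have pz : prefix (a ++ take (size y).+1 x) (a ++ x).
  by rewrite prefix_catr // ?eqxx //= prefix_take.
have az : prefix a (a ++ take (size y).+1 x) by rewrite prefix_prefix.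
exists (a ++ take (size y).+1 x); split=> //.
  have [|u eu] := @segment_last s0 _ _ az.
    apply/eqP => /(congr1 size) /eqP; rewrite size_cat size_takel.
      by rewrite -{1}(addn0 (size a)) eqn_add2l.
    by rewrite sx addnS ltnS leq_addr.
  by move: eu; rewrite ez => /rcons_inj [].
have := segment_trans s0 az pz.
by rewrite segment_catE ez e -cat_rcons => /eqP; rewrite eqseq_cat // eqxx => /eqP.
Qed.

(** * The game on two unravellings *)

Section Game.
Variables (sim : nat -> S -> S -> Prop) (lab : S -> bool).
Hypothesis sim_lab : forall n s s', sim n s s' -> lab s = lab s'.
Hypothesis simS : forall n s s', sim n.+1 s s' -> sim n s s'.
Hypothesis sim_sym : forall n s s', sim n s s' -> sim n s' s.

Definition walk (f : nat -> S) : Prop := forall i, step (f i) (f i.+1).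

(** The part of a path visible to Boolean combinations of X and U: the types of its finite prefixes,
    each paired with the letter that comes next. Neither the order nor the number of occurrences is
    kept. *)
Definition same_types n (f f' : nat -> S) : Prop :=
  (forall j, exists j', word_game (sim n) n (mkseq f j) (mkseq f' j') /\ sim n (f j) (f' j'))
  /\ (forall j', exists j, word_game (sim n) n (mkseq f j) (mkseq f' j') /\ sim n (f j) (f' j')).

Hypothesis sim_walk : forall n s s' f, sim n.+1 s s' -> walk f -> f 0 = s ->
  exists f', [/\ walk f', f' 0 = s' & same_types n (f \o succn) (f' \o succn)].

(* A position of the game on two unravellings: a finite list of matched nodes. *)
Record good n s0 s0' (L : seq (unode * unode)) : Prop := Good {
  good_root : ([::], [::]) \in L;
  good_prefix : forall e f, e \in L -> f \in L -> prefix e.1 f.1 = prefix e.2 f.2;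
  good_lcp : forall e f, e \in L -> f \in L -> (lcp e.1 f.1, lcp e.2 f.2) \in L;
  good_state : forall e, e \in L -> sim n (state s0 e.1) (state s0' e.2);
  good_segment : forall e f, e \in L -> f \in L -> prefix e.1 f.1 ->
    word_game (sim n) n (segment s0 e.1 f.1) (segment s0' e.2 f.2)
}.

Lemma goodS n s0 s0' L : good n.+1 s0 s0' L -> good n s0 s0' L.
Proof.
case=> H0 H1 H2 H3 H4; split=> // [e eL|e f eL fL ef].
  exact/simS/H3.
by apply: (@word_game_mono _ (sim n.+1)); [move=> ? ?; apply: simS|apply/word_gameS/H4].
Qed.

Lemma good_eq_mem n s0 s0' L1 L2 : L1 =i L2 -> good n s0 s0' L1 -> good n s0 s0' L2.
Proof.
move=> e12 [H0 H1 H2 H3 H4]; split=> [|e f|e f|e|e f]; rewrite -!e12; auto.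
Qed.

Lemma good_sym n s0 s0' L : good n s0 s0' L -> good n s0' s0 [seq (e.2, e.1) | e <- L].
Proof.
case=> H0 H1 H2 H3 H4; split.
- by apply/mapP; exists ([::], [::]).
- by move=> _ _ /mapP [e eL ->] /mapP [f fL ->] /=; rewrite H1.
- move=> _ _ /mapP [e eL ->] /mapP [f fL ->] /=.
  by apply/mapP; exists (lcp e.1 f.1, lcp e.2 f.2); rewrite ?H2.
- by move=> _ /mapP [e eL ->] /=; apply/sim_sym/H3.
move=> _ _ /mapP [e eL ->] /mapP [f fL ->] /= ef.
by apply: word_game_sym; [apply: sim_sym|apply: H4 => //; rewrite H1].
Qed.

Lemma good_nil n s0 s0' : sim n s0 s0' -> good n s0 s0' [:: ([::], [::])].
Proof.
move=> H; split=> [|e f|e f|e|e f]; rewrite ?mem_head // !inE => /eqP -> //=;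
  first by move=> /eqP ->.
by move=> /eqP -> _; rewrite !segment_refl; apply: word_game_nil.
Qed.

(** The order [r] is abstract because both [leq] and [geq] are used: the first for the longest
    matched prefix of a node, the second for its shortest matched extension. *)
Lemma seq_extremum (T : eqType) (r : rel nat) (P : pred T) (m : T -> nat) (x : T) (s : seq T) :
  total r -> transitive r -> x \in s -> P x ->
  exists2 y, y \in s & P y /\ forall z : T, z \in s -> P z -> r (m z) (m y).
Proof.
move=> rt rtr; elim: s x => // t s IH x.
rewrite inE => xs Px.
have rr k : r k k by have := rt k k; rewrite orbb.
case: (boolP (has P s)) => [/hasP [u us Pu]|/hasPn nP].
  have [y ys [Py Hy]] := IH u us Pu.
  case: (boolP (P t && ~~ r (m t) (m y))) => [/andP [Pt nr]|nr].
    have ryt : r (m y) (m t) by have := rt (m y) (m t); rewrite (negPf nr) orbF.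
    exists t; rewrite ?mem_head //; split=> // z; rewrite inE => /orP [/eqP -> //|zs Pz].
    exact: rtr (Hy _ zs Pz) ryt.
  exists y; rewrite ?inE ?ys ?orbT //; split=> // z; rewrite inE => /orP [/eqP ->|]; last exact: Hy.
  by move=> Pt; move: nr; rewrite Pt negbK.
exists x; rewrite ?inE //; split=> // z; rewrite inE.
case/orP: xs => [/eqP ex|xs]; last by move: (nP _ xs); rewrite Px.
by move=> /orP [/eqP ->|/nP /negPf ->] //; rewrite ex.
Qed.

(** An unmatched [z] lies in the gap between its closest matched neighbours [c] and [b]. It marks a
    letter of that segment, and one round of the word game yields the letter, hence the node, that
    answers it. *)
Lemma good_between n s0 s0' L (b : unode * unode) z : good n.+1 s0 s0' L -> b \in L -> prefix z b.1 ->
  exists z', good n s0 s0' ((z, z') :: L).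
Proof.
move=> G bL0 zb0; case: (boolP (has (fun e => e.1 == z) L)) => [/hasP [e eL /eqP ez]|/hasPn nz].
  exists e.2; apply: good_eq_mem (goodS G) => x.
  by rewrite inE; case: eqP => // ->; rewrite -ez -surjective_pairing eL.
have [c cL [cz cmax]] := @seq_extremum _ leq (fun e => prefix e.1 z) (fun e => size e.1) _ L
  leq_total leq_trans (good_root G) (prefix0s _).
have [{bL0 zb0}b1 bL [zb bmin]] := @seq_extremum _ geq (fun e => prefix z e.1) (fun e => size e.1) _ L
  (fun i j => leq_total j i) (fun i j k h1 h2 => leq_trans h2 h1) bL0 zb0.
clear b; rename b1 into b.
have {}cmax e : e \in L -> prefix e.1 z -> prefix e.1 c.1.
  by move=> eL ez; apply: (prefix_comparable ez cz); apply: cmax.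
(* The common prefix of [b] and [e] is matched and still extends [z], so by minimality it is [b]
   itself. *)
have {}bmin e : e \in L -> prefix z e.1 -> prefix b.1 e.1.
  move=> eL ez; have lL := good_lcp G bL eL.
  have := bmin _ lL; rewrite /= prefix_lcp zb ez => /(_ isT) le.
  have <- : lcp b.1 e.1 = b.1; last exact: lcp_prefixr.
  apply: prefix_anti (lcp_prefixl _ _) _.
  exact: prefix_comparable (prefix_refl _) (lcp_prefixl _ _) le.
have cb : prefix c.1 b.1 := prefix_trans cz zb.
have [y ey] := @segment_last s0 _ _ cz (nz _ cL).
have [E _] := good_segment G cL bL cb.
have := E y (state s0 z) (segment s0 z b.1).
rewrite (segment_trans s0 cz zb) ey cat_rcons => /(_ erefl) [y' [s' [t' [e' Ey Es Et]]]].
have cb' : prefix c.2 b.2 by rewrite -(good_prefix G).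
have [z' [cz' zb' ez' st' et']] := segment_split cb' e'.
exists z'.
have c'z' : size c.2 < size z'.
  by rewrite -subn_gt0 -(size_segment s0') ez' size_rcons.
(* The piece after [z] is nonempty since [z] is not matched, and the game preserves emptiness. *)
have z'b' : size z' < size b.2.
  rewrite -subn_gt0 -(size_segment s0') et' lt0n -/(nilp t') -(word_game_nilp Et).
  rewrite /nilp size_segment -lt0n subn_gt0 ltn_neqAle size_prefix // andbT.
  apply: contra (nz _ bL) => /eqP ezb; apply/eqP/prefix_anti => //.
  exact: prefix_comparable (prefix_refl _) zb (eq_leq (esym ezb)).
have below e : e \in L -> prefix e.1 z = prefix e.2 z'.
  move=> eL; apply/idP/idP => [ez|fz'].
    by apply: prefix_trans cz'; rewrite -(good_prefix G) // cmax.
  have eb : prefix e.1 b.1 by rewrite (good_prefix G) // (prefix_trans fz').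
  case: (leqP (size e.1) (size z)) => [|/ltnW] le; first exact: prefix_comparable eb zb le.
  have := bmin _ eL (prefix_comparable zb eb le).
  rewrite (good_prefix G) // => be.
  by have := size_prefix (prefix_trans be fz'); rewrite leqNgt z'b'.
have above e : e \in L -> prefix z e.1 = prefix z' e.2.
  move=> eL; apply/idP/idP => [ze|ze'].
    by apply: prefix_trans zb' _; rewrite -(good_prefix G) // bmin.
  have lL := good_lcp G bL eL.
  case: (leqP (size z) (size (lcp b.1 e.1))) => [|/ltnW] le.
    by have := prefix_comparable zb (lcp_prefixl _ _) le; rewrite prefix_lcp => /andP [].
  have := cmax _ lL (prefix_comparable (lcp_prefixl _ _) zb le).
  rewrite (good_prefix G) //= => lc.
  have zl' : prefix z' (lcp b.2 e.2) by rewrite prefix_lcp zb' ze'.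
  by have := size_prefix (prefix_trans zl' lc); rewrite leqNgt c'z'.
have lcpz e : e \in L -> (lcp z e.1, lcp z' e.2) \in (z, z') :: L.
  move=> eL; case: (boolP (prefix z e.1)) => ze.
    by rewrite !lcp_idPl -?above // mem_head.
  rewrite (lcp_below zb) // (lcp_below zb') -?above //.
  by rewrite inE (good_lcp G) // orbT.
have G1 := goodS G.
have Ezb : word_game (sim n) n (segment s0 z b.1) (segment s0' z' b.2).
  by rewrite et'; apply: word_game_mono Et => ? ?; apply: simS.
have Ecz : word_game (sim n) n (segment s0 c.1 z) (segment s0' c.2 z').
  rewrite ey ez' -!cats1; apply: (@word_game_mono _ (sim n.+1)); first by move=> ? ?; apply: simS.
  by apply: word_game_cat => //; apply: word_game1.
split.
- by rewrite inE (good_root G) orbT.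
- move=> e f; rewrite !inE => /orP [/eqP ->|eL] /orP [/eqP ->|fL] /=; rewrite ?prefix_refl //.
  + exact: above.
  + exact: below.
  + exact: good_prefix G _ _ eL fL.
- move=> e f; rewrite !inE => /orP [/eqP ->|eL] /orP [/eqP ->|fL] /=; rewrite -?in_cons.
  + by rewrite !lcp_idPl ?prefix_refl ?mem_head.
  + exact: lcpz.
  + by rewrite lcpC [lcp e.2 _]lcpC lcpz.
  + by rewrite inE (good_lcp G) ?orbT.
- move=> e; rewrite inE => /orP [/eqP -> /=|eL]; last exact: good_state G1 _ eL.
  by rewrite st'; apply: simS.
move=> e f; rewrite !inE => /orP [/eqP ->|eL] /orP [/eqP ->|fL] /= ef.
- by rewrite !segment_refl; apply: word_game_nil.
- have bf := bmin _ fL ef.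
  rewrite (segment_trans _ zb bf) (segment_trans s0' zb') -?(good_prefix G) //.
  by apply: word_game_cat => //; apply: good_segment G1 _ _ bL fL bf.
- have ec := cmax _ eL ef.
  rewrite (segment_trans _ ec cz) (segment_trans s0' _ cz') -?(good_prefix G) //.
  by apply: word_game_cat => //; apply: good_segment G1 _ _ eL cL ec.
exact: good_segment G1 _ _ eL fL ef.
Qed.

(** The new nodes leave the matched trees at [z]: no matched node extends them, and they have the
    same common prefixes with matched nodes as [z] has. Every clause thus reduces to [z] and the one
    segment from [z] to the new node. *)
Lemma good_fresh n s0 s0' L (z : unode * unode) w w' : good n s0 s0' L -> z \in L ->
  prefix z.1 w -> prefix z.2 w' ->
  (forall e, e \in L -> prefix (lcp w e.1) z.1) ->
  (forall e, e \in L -> prefix (lcp w' e.2) z.2) ->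
  z.1 != w -> z.2 != w' ->
  sim n (state s0 w) (state s0' w') ->
  word_game (sim n) n (segment s0 z.1 w) (segment s0' z.2 w') ->
  good n s0 s0' ((w, w') :: L).
Proof.
move=> G zL zw zw' F F' nzw nzw' Es Ew.
have below e : e \in L -> prefix e.1 w = prefix e.1 z.1.
  move=> eL; apply/idP/idP => [ew|ez]; last exact: prefix_trans ez zw.
  by apply: prefix_trans (F _ eL); rewrite prefix_lcp ew prefix_refl.
have below' e : e \in L -> prefix e.2 w' = prefix e.2 z.2.
  move=> eL; apply/idP/idP => [ew|ez]; last exact: prefix_trans ez zw'.
  by apply: prefix_trans (F' _ eL); rewrite prefix_lcp ew prefix_refl.
have above e : e \in L -> prefix w e.1 = false.
  move=> eL; apply: contraNF nzw => we; apply/eqP/prefix_anti => //.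
  by have := F _ eL; rewrite lcp_idPl.
have above' e : e \in L -> prefix w' e.2 = false.
  move=> eL; apply: contraNF nzw' => we; apply/eqP/prefix_anti => //.
  by have := F' _ eL; rewrite lcp_idPl.
have lcpw e : e \in L -> (lcp w e.1, lcp w' e.2) \in (w, w') :: L.
  move=> eL; have -> : lcp w e.1 = lcp z.1 e.1.
    apply: prefix_anti; rewrite prefix_lcp lcp_prefixr ?F //.
    by rewrite (prefix_trans (lcp_prefixl _ _)).
  have -> : lcp w' e.2 = lcp z.2 e.2.
    apply: prefix_anti; rewrite prefix_lcp lcp_prefixr ?F' //.
    by rewrite (prefix_trans (lcp_prefixl _ _)).
  by rewrite inE (good_lcp G) ?orbT.
split.
- by rewrite inE (good_root G) orbT.
- move=> e f; rewrite !inE => /orP [/eqP ->|eL] /orP [/eqP ->|fL] /=; rewrite ?prefix_refl //.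
  + by rewrite above ?above'.
  + by rewrite below ?below' // (good_prefix G).
  + exact: good_prefix G _ _ eL fL.
- move=> e f; rewrite !inE => /orP [/eqP ->|eL] /orP [/eqP ->|fL] /=; rewrite -?in_cons.
  + by rewrite !lcp_idPl ?prefix_refl ?mem_head.
  + exact: lcpw.
  + by rewrite lcpC [lcp e.2 _]lcpC lcpw.
  + by rewrite inE (good_lcp G) ?orbT.
- by move=> e; rewrite inE => /orP [/eqP -> //|eL]; last exact: good_state G _ eL.
move=> e f; rewrite !inE => /orP [/eqP ->|eL] /orP [/eqP ->|fL] /= ef.
- by rewrite !segment_refl; apply: word_game_nil.
- by rewrite above in ef.
- rewrite below // in ef; rewrite (segment_trans _ ef zw) (segment_trans s0' _ zw') -?(good_prefix G) //.
  by apply: word_game_cat => //; apply: good_segment G _ _ eL zL ef.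
exact: good_segment G _ _ eL fL ef.
Qed.

Lemma good_between_r n s0 s0' L (b : unode * unode) z' :
  good n.+1 s0 s0' L -> b \in L -> prefix z' b.2 ->
  exists z, good n s0 s0' ((z, z') :: L).
Proof.
move=> /good_sym G bL zb.
have [|z /good_sym /= Gz] := good_between (b := (b.2, b.1)) G _ zb.
  by apply/mapP; exists b.
exists z; apply: good_eq_mem Gz => e; rewrite !inE; congr (_ || _).
by rewrite -map_comp (eq_map (g := id)) ?map_id // => -[].
Qed.

(** * Infinite branches and how they are answered *)

Definition branch (f : nat -> unode) : Prop := forall i, exists l, f i.+1 = rcons (f i) l.

Lemma branch_size f i : branch f -> size (f i) = size (f 0) + i.
Proof.
move=> fb; elim: i => [|i IH]; first by rewrite addn0.
by have [l ->] := fb i; rewrite size_rcons IH addnS.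
Qed.

Lemma branch_prefix f i j : branch f -> i <= j -> prefix (f i) (f j).
Proof.
move=> fb; elim: j => [|j IH]; first by rewrite leqn0 => /eqP ->; apply: prefix_refl.
rewrite leq_eqVlt => /orP [/eqP ->|ij]; first exact: prefix_refl.
by have [l ->] := fb j; apply: prefix_trans (IH ij) (prefix_rcons _ _).
Qed.

Lemma branch_between f j z : branch f -> prefix (f 0) z -> prefix z (f j) ->
  exists2 i, i <= j & z = f i.
Proof.
move=> fb fz zf; exists (size z - size (f 0)).
  by rewrite leq_subLR -branch_size // size_prefix.
have s1 : size z = size (f (size z - size (f 0))).
  by rewrite branch_size // subnKC // size_prefix.
have lej : size z - size (f 0) <= j by rewrite leq_subLR -branch_size // size_prefix.
apply: prefix_anti.
  by apply: prefix_comparable zf (branch_prefix fb lej) _; rewrite -s1.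
by apply: prefix_comparable (branch_prefix fb lej) zf _; rewrite -s1.
Qed.

(** Every state has infinitely many copies, and a position mentions only finitely many copy numbers.
    A branch using a larger one cannot meet matched nodes again. *)
Lemma fresh_index (L : seq (unode * unode)) :
  exists J, forall e, e \in L -> forall l, l \in e.2 -> l.2 < J.
Proof.
elim: L => [|e L [J HJ]]; first by exists 0.
have [J1 HJ1] : exists J1, forall l, l \in e.2 -> l.2 < J1.
  elim: (e.2) => [|l w [J1 HJ1]]; first by exists 0.
  exists (maxn l.2.+1 J1) => l'; rewrite inE leq_max => /orP [/eqP ->|/HJ1 ->].
    by rewrite leqnn.
  by rewrite orbT.
exists (maxn J1 J) => f; rewrite inE => /orP [/eqP ->|fL] l lf; rewrite leq_max.
  by rewrite HJ1.
by rewrite (HJ f fL) ?orbT.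
Qed.

Lemma branch_leaves (L : seq (unode * unode)) f : branch f ->
  has (fun e => prefix (f 0) e.1) L ->
  exists j, has (fun e => prefix (f j) e.1) L /\
            forall e, e \in L -> ~~ prefix (f j.+1) e.1.
Proof.
move=> fb h0.
pose P j := has (fun e : unode * unode => prefix (f j) e.1) L.
have bd j : P j -> j <= \max_(e <- L) size e.1.
  move=> /hasP [e eL /size_prefix le].
  apply: leq_trans (leq_bigmax_seq (F := fun e : unode * unode => size e.1) _ eL isT).
  by apply: leq_trans le; rewrite branch_size // leq_addl.
case: (@ex_maxnP P _ (ex_intro _ 0 h0) bd) => j Pj jmax.
exists j; split=> // e eL; apply/negP => pe.
by have := jmax j.+1; rewrite ltnn => /(_ (introT hasP (ex_intro2 _ _ e eL pe))).
Qed.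

Lemma lcp_leaves z w l e : prefix (rcons z l) w -> ~~ prefix (rcons z l) e ->
  prefix (lcp w e) z.
Proof.
move=> zw nze; have zw' := prefix_trans (prefix_rcons z l) zw.
case: (leqP (size (lcp w e)) (size z)) => [|] le.
  exact: prefix_comparable (lcp_prefixl _ _) zw' le.
have := prefix_comparable zw (lcp_prefixl w e).
rewrite size_rcons => /(_ le) /prefix_trans /(_ (lcp_prefixr w e)).
by rewrite (negPf nze).
Qed.

(** Let [z] be the last node of [f] with a matched extension. The answer goes from [v'] to the
    partner [z'] of [z] and from there along the walk supplied by [sim_walk]. One level is spent on
    matching [z], a second one on a node before [z] or on the walk after it. *)
Lemma branch_match n s0 s0' L v v' f : good n.+3 s0 s0' L -> (v, v') \in L ->
  branch f -> f 0 = v ->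
  exists f', [/\ branch f', f' 0 = v',
    (forall j, exists j' L1, [/\ good n.+1 s0 s0' L1, {subset L <= L1} & (f j, f' j') \in L1])
  & (forall j', exists j L1, [/\ good n.+1 s0 s0' L1, {subset L <= L1} & (f j, f' j') \in L1])].
Proof.
move=> G vL fb f0.
have [j0 [/hasP [b bL zb] leave]] : exists j, has (fun e => prefix (f j) e.1) L /\
    forall e, e \in L -> ~~ prefix (f j.+1) e.1.
  by apply: branch_leaves => //; apply/hasP; exists (v, v'); rewrite ?f0 ?prefix_refl.
have [z' G1] := good_between G bL zb.
set z := f j0 in zb G1; set L1 := (z, z') :: L in G1.
have zL1 : (z, z') \in L1 by rewrite mem_head.
have sub1 : {subset L <= L1} by move=> e eL; rewrite inE eL orbT.
have vz : prefix v z by rewrite -f0 branch_prefix.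
have vz' : prefix v' z' by rewrite -(good_prefix G1 (sub1 _ vL) zL1).
pose sg i := state s0 (f (j0 + i)).
have wsg : walk sg.
  move=> i; rewrite /sg addnS; have [l ->] := fb (j0 + i).
  by rewrite state_rcons step_move.
have [sg' [wsg' sg'0 [T1 T2]]] : exists f', [/\ walk f', f' 0 = state s0' z' &
    same_types n.+1 (sg \o succn) (f' \o succn)].
  by apply: sim_walk (good_state G1 zL1) wsg _; rewrite /sg addn0.
have [J HJ] := fresh_index L1.
(* The copy number [J] occurs in no matched node, so the answer leaves all of them at its first step
   after [z']. *)
pose lam i : S * nat := (sg' i.+1, J).
have stl i : state s0' (z' ++ mkseq lam i) = sg' i.
  elim: i => [|i IH]; first by rewrite /= cats0.
  by rewrite mkseqS -rcons_cat state_rcons IH /move /= wsg'.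
have sgl i : segment s0' z' (z' ++ mkseq lam i) = mkseq (sg' \o succn) i.
  elim: i => [|i IH]; first by rewrite cats0 segment_refl.
  by rewrite !mkseqS -rcons_cat segment_rcons ?prefix_prefix // IH rcons_cat -mkseqS stl.
have sgf i : segment s0 z (f (j0 + i)) = mkseq (sg \o succn) i.
  elim: i => [|i IH]; first by rewrite addn0 segment_refl.
  rewrite mkseqS addnS /= /sg addnS; have [l ->] := fb (j0 + i).
  by rewrite segment_rcons ?IH // branch_prefix ?leq_addr.
(* One formula for both stretches: up to length [size z'] the truncated subtraction makes the tail
   empty, and beyond it [take] returns all of [z']. *)
pose g i := take (size v' + i) z' ++ mkseq lam (size v' + i - size z').
have g0 : g 0 = v'.
  rewrite /g addn0 (eqP (size_prefix vz' : size v' - size z' == 0)) cats0.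
  by apply/eqP; rewrite -prefixE.
have glow y : prefix v' y -> prefix y z' -> y = g (size y - size v').
  move=> vy yz; rewrite /g subnKC ?size_prefix //.
  rewrite (eqP (size_prefix yz : size y - size z' == 0)) cats0.
  by apply/esym/eqP; rewrite -prefixE.
have ghigh i : z' ++ mkseq lam i = g (size z' - size v' + i).
  by rewrite /g addnA subnKC ?size_prefix // addKn take_oversize ?leq_addr.
have gb : branch g.
  move=> i; rewrite /g addnS.
  case: (ltnP (size v' + i) (size z')) => le.
    exists (nth (sg' 0, 0) z' (size v' + i)).
    rewrite (eqP (le : (size v' + i).+1 - size z' == 0)).
    rewrite (eqP (ltnW le : size v' + i - size z' == 0)) !cats0.
    by rewrite (take_nth (sg' 0, 0)).
  by exists (lam (size v' + i - size z')); rewrite subSn // mkseqS -rcons_cat !take_oversize // leqW.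
have high i i' :
    word_game (sim n.+1) n.+1 (mkseq (sg \o succn) i) (mkseq (sg' \o succn) i') ->
    sim n.+1 (sg i.+1) (sg' i'.+1) ->
    good n.+1 s0 s0' ((f (j0 + i.+1), z' ++ mkseq lam i'.+1) :: L1).
  move=> Ew Es.
  have [l el] := fb j0.
  have pf : prefix (f j0.+1) (f (j0 + i.+1)) by rewrite branch_prefix // addnS ltnS leq_addr.
  have pl : prefix (rcons z' (lam 0)) (z' ++ mkseq lam i'.+1).
    by rewrite -cats1 prefix_catr //= !eqxx /= prefix0s.
  apply: (good_fresh (goodS G1) zL1) => /=.
  - by rewrite branch_prefix ?leq_addr.
  - exact: prefix_prefix.
  - move=> e; rewrite inE => /orP [/eqP -> /=|eL]; first exact: lcp_prefixr.
    rewrite el in pf; apply: lcp_leaves pf _.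
    by rewrite -el leave.
  - move=> e eL; apply: lcp_leaves pl _.
    apply/negP => /prefixP [r er]; have := HJ _ eL (lam 0).
    by rewrite er mem_cat mem_rcons mem_head ltnn => /(_ isT).
  - apply/eqP => /(congr1 size) /eqP; rewrite /z (branch_size j0 fb) (branch_size (j0 + _) fb).
    by rewrite eqn_add2l -{1}(addn0 j0) eqn_add2l.
  - apply/eqP => /(congr1 size) /eqP; rewrite size_cat size_mkseq.
    by rewrite -{1}(addn0 (size z')) eqn_add2l.
  - by rewrite stl.
  rewrite sgf sgl !mkseqS -!cats1.
  exact: (word_game_cat (n := n.+1) Ew (word_game1 n.+1 Es)).
exists g; split=> // [j|j'].
  case: (leqP j j0) => le.
    have [y Gy] := good_between (b := (z, z')) G1 zL1 (branch_prefix fb le).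
    have yL : (f j, y) \in (f j, y) :: L1 by rewrite mem_head.
    have sub2 : {subset L1 <= (f j, y) :: L1} by move=> e eL; rewrite inE eL orbT.
    exists (size y - size v'), ((f j, y) :: L1); split=> //.
      by move=> e /sub1 /sub2.
    rewrite -glow ?mem_head //.
      rewrite -(good_prefix Gy (sub2 _ (sub1 _ vL)) yL) /= -f0 branch_prefix //.
    by rewrite -(good_prefix Gy yL (sub2 _ zL1)) /= branch_prefix.
  have [i ->] : exists i, j = j0 + i.+1 by exists (j - j0.+1); rewrite addnS -addSn subnKC.
  have [i' [Ew Es]] := T1 i.
  exists (size z' - size v' + i'.+1), ((f (j0 + i.+1), z' ++ mkseq lam i'.+1) :: L1).
  split; first exact: high.
    by move=> e eL; rewrite inE sub1 ?orbT.
  by rewrite -ghigh mem_head.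
case: (leqP (size v' + j') (size z')) => le.
  have ey : g j' = take (size v' + j') z' by rewrite /g (eqP (le : _ - _ == 0)) cats0.
  have yz : prefix (g j') z' by rewrite ey prefix_take.
  have vy : prefix v' (g j') by rewrite -g0 branch_prefix.
  have [y Gy] := good_between_r (b := (z, z')) G1 zL1 yz.
  have yL : (y, g j') \in (y, g j') :: L1 by rewrite mem_head.
  have sub2 : {subset L1 <= (y, g j') :: L1} by move=> e eL; rewrite inE eL orbT.
  have [||i _ ei] := @branch_between f j0 y fb.
  - by rewrite f0 (good_prefix Gy (sub2 _ (sub1 _ vL)) yL).
  - by rewrite (good_prefix Gy yL (sub2 _ zL1)).
  exists i, ((y, g j') :: L1); split=> //.
    by move=> e /sub1 /sub2.
  by rewrite -ei.
have [i [Ew Es]] := T2 (size v' + j' - (size z').+1).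
exists (j0 + i.+1), ((f (j0 + i.+1), z' ++ mkseq lam (size v' + j' - (size z').+1).+1) :: L1).
split; first exact: high.
  by move=> e eL; rewrite inE sub1 ?orbT.
rewrite subnSK // ghigh.
have -> : size z' - size v' + (size v' + j' - size z') = j'; last by rewrite mem_head.
apply/eqP; rewrite -(eqn_add2l (size v')) addnA subnKC ?size_prefix //.
by rewrite subnKC // ltnW.
Qed.

(** * Invariance of formulas under the game *)

Section Logic.
Variables (AP : Type) (p : AP).

Lemma root_no_parent_word s0 : forall v : unode, ~ (exists l, [::] = rcons v l).
Proof. by case=> [|? ?] []. Qed.

Lemma parent_unique_word (v v' w : unode) :
  (exists l, w = rcons v l) -> (exists l, w = rcons v' l) -> v = v'.
Proof. by move=> [l ->] [l' /rcons_inj []]. Qed.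

Lemma root_reaches_word (v : unode) :
  clos_refl_trans unode (fun a b => exists l, b = rcons a l) [::] v.
Proof.
elim/last_ind: v => [|v l IH]; first exact: rt_refl.
by apply: rt_trans IH _; apply: rt_step; exists l.
Qed.

Definition unravelling s0 : tree AP :=
  @Tree AP unode [::] (fun a b => exists l, b = rcons a l)
    (fun w => fun q => q = p /\ lab (state s0 w))
    (root_no_parent_word s0) parent_unique_word root_reaches_word.

(** Every word can be extended, so there are no leaves and all paths are infinite. *)
Lemma path_fromP s0 (v : unravelling s0) pi : path_from v pi <->
  exists f, [/\ branch f, f 0 = v & pi = Some \o f].
Proof.
split=> [[pi0 _ Hedge Hmax]|[f [fb f0 ->]]].
  have tot i : exists w, pi i = Some w.
    elim: i => [|i [w ew]]; first by exists v.
    case e: (pi i.+1) => [w'|]; first by exists w'.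
    by case: (Hmax _ _ ew e (rcons w (s0, 0))); exists (s0, 0).
  pose f i := if pi i is Some w then w else v.
  have ef i : pi i = Some (f i) by rewrite /f; have [w ->] := tot i.
  exists f; split.
  - by move=> i; apply: (Hedge i) => //.
  - by move: pi0; rewrite ef => -[].
  by apply: funext => i; rewrite ef.
split=> //=.
- by rewrite f0.
- by move=> i w w' [<-] [<-]; apply: fb.
Qed.

(** Only path quantifiers cost anything: two levels for [branch_match] and one for matching the
    positions before a given one, as U demands. *)
Fixpoint sdepth k (phi : sform AP k) : nat :=
  match phi with
  | SAtom _ | SVar _ | SRoot => 0
  | SNot phi1 | SBind _ phi1 | SAt _ phi1 | SAtRoot phi1 => sdepth phi1
  | SOr phi1 phi2 | SAnd phi1 phi2 => maxn (sdepth phi1) (sdepth phi2)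
  | SE psi | SA psi => (pdepth psi).+3
  end
with pdepth k (psi : pform AP k) : nat :=
  match psi with
  | PState phi => sdepth phi
  | PNot psi1 | PX psi1 => pdepth psi1
  | POr psi1 psi2 | PAnd psi1 psi2 | PU psi1 psi2 => maxn (pdepth psi1) (pdepth psi2)
  end.

Definition config k n s0 s0' (v v' : unode) (u u' : 'I_k -> unode) : Prop :=
  exists L, [/\ good n s0 s0' L, (v, v') \in L & forall i, (u i, u' i) \in L].

(** Made for U and X. A witness [j] of U is answered by some [j'] such that each position before
    [j'] has a partner before [j], which carries the left argument of U over. X needs the two
    positions 1 to be partners. *)
Definition matched k n s0 s0' (f f' : nat -> unode) (u u' : 'I_k -> unode) : Prop :=
  [/\ forall j, exists j', config n s0 s0' (f j) (f' j') u u' /\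
        forall l', l' < j' -> exists2 l, l < j & config n s0 s0' (f l) (f' l') u u',
      forall j', exists j, config n s0 s0' (f j) (f' j') u u' /\
        forall l, l < j -> exists2 l', l' < j' & config n s0 s0' (f l) (f' l') u u'
    & config n s0 s0' (f 1) (f' 1) u u'].

Lemma config_sym k n s0 s0' v v' (u u' : 'I_k -> unode) :
  config n s0 s0' v v' u u' -> config n s0' s0 v' v u' u.
Proof.
move=> [L [G vL uL]]; exists [seq (e.2, e.1) | e <- L]; split.
- exact: good_sym.
- by apply/mapP; exists (v, v').
- by move=> i; apply/mapP; exists (u i, u' i).
Qed.

Lemma matched_sym k n s0 s0' f f' (u u' : 'I_k -> unode) :
  matched n s0 s0' f f' u u' -> matched n s0' s0 f' f u' u.
Proof.
case=> H1 H2 H3; split; last exact: config_sym.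
  move=> j; have [j' [C H]] := H2 j; exists j'; split; first exact: config_sym.
  by move=> l /H [l' ? /config_sym ?]; exists l'.
move=> j; have [j' [C H]] := H1 j; exists j'; split; first exact: config_sym.
by move=> l /H [l' ? /config_sym ?]; exists l'.
Qed.

Lemma config_branch k n s0 s0' f v' (u u' : 'I_k -> unode) :
  config n.+3 s0 s0' (f 0) v' u u' -> branch f ->
  exists f', [/\ branch f', f' 0 = v' & matched n s0 s0' f f' u u'].
Proof.
move=> [L [G vL uL]] fb.
have [f' [fb' f'0 H1 H2]] := branch_match G vL fb erefl.
pose ext a b := exists L2, [/\ good n s0 s0' L2, {subset L <= L2} & (a, b) \in L2].
have fwd j j' L1 : good n.+1 s0 s0' L1 -> {subset L <= L1} -> (f j, f' j') \in L1 ->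
    forall l, l < j -> exists2 l', l' < j' & ext (f l) (f' l').
  move=> G1 sub1 jL l lj.
  have [z' Gz] := good_between G1 jL (branch_prefix fb (ltnW lj)).
  have sub2 : {subset L1 <= (f l, z') :: L1} by move=> e eL; rewrite inE eL orbT.
  have zL := mem_head (f l, z') L1.
  have zj : prefix z' (f' j') by rewrite -(good_prefix Gz zL (sub2 _ jL)) branch_prefix // ltnW.
  have vz : prefix (f' 0) z'.
    by rewrite f'0 -(good_prefix Gz (sub2 _ (sub1 _ vL)) zL) branch_prefix.
  have [i ij ei] := branch_between fb' vz zj.
  exists i.
    rewrite ltn_neqAle ij andbT; apply/eqP => eij; subst i z'.
    have := good_prefix Gz (sub2 _ jL) zL; rewrite /= prefix_refl => /size_prefix.
    by rewrite (branch_size j fb) (branch_size l fb) leq_add2l leqNgt lj.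
  exists ((f l, z') :: L1); rewrite -ei; split=> // e eL.
  exact/sub2/sub1.
have bwd j j' L1 : good n.+1 s0 s0' L1 -> {subset L <= L1} -> (f j, f' j') \in L1 ->
    forall l', l' < j' -> exists2 l, l < j & ext (f l) (f' l').
  move=> G1 sub1 jL l lj.
  have [z Gz] := good_between_r G1 jL (branch_prefix fb' (ltnW lj)).
  have sub2 : {subset L1 <= (z, f' l) :: L1} by move=> e eL; rewrite inE eL orbT.
  have zL := mem_head (z, f' l) L1.
  have zj : prefix z (f j) by rewrite (good_prefix Gz zL (sub2 _ jL)) branch_prefix // ltnW.
  have vz : prefix (f 0) z.
    by rewrite (good_prefix Gz (sub2 _ (sub1 _ vL)) zL) /= -f'0 branch_prefix.
  have [i ij ei] := branch_between fb vz zj.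
  exists i.
    rewrite ltn_neqAle ij andbT; apply/eqP => eij; subst i z.
    have := good_prefix Gz (sub2 _ jL) zL; rewrite /= prefix_refl => /esym/size_prefix.
    by rewrite (branch_size j' fb') (branch_size l fb') leq_add2l leqNgt lj.
  exists ((z, f' l) :: L1); rewrite -ei; split=> // e eL.
  exact/sub2/sub1.
have conf a b : ext a b -> config n s0 s0' a b u u'.
  by move=> [L2 [G2 sub2 ab]]; exists L2; split=> // i; apply/sub2/uL.
exists f'; split=> //; split.
- move=> j; have [j' [L1 [G1 sub1 jL]]] := H1 j; exists j'; split.
    by apply: conf; exists L1; split=> //; apply: goodS.
  by move=> l' /(bwd _ _ _ G1 sub1 jL) [l lj /conf]; exists l.
- move=> j'; have [j [L1 [G1 sub1 jL]]] := H2 j'; exists j; split.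
    by apply: conf; exists L1; split=> //; apply: goodS.
  by move=> l' /(fwd _ _ _ G1 sub1 jL) [l lj /conf]; exists l.
(* The partner of position 1 is position 1: it is not 0, and if it were larger, position 1 on the
   right would be matched with position 0 on the left, whose partner is position 0. *)
have [j' [L1 [G1 sub1 jL]]] := H1 1.
have [l' lj' _] := fwd _ _ _ G1 sub1 jL 0 isT.
case: j' lj' jL => // [[|j']] _ jL.
  by apply: conf; exists L1; split=> //; apply: goodS.
have [[|//] _ [L2 [G2 sub2 e2]]] := bwd _ _ _ G1 sub1 jL 1 isT.
have := good_prefix G2 e2 (sub2 _ vL); rewrite /= prefix_refl -f'0 => /esym/size_prefix.
by rewrite (branch_size 1 fb') addn1 ltnn.
Qed.

Definition sform_invariant k (phi : sform AP k) : Prop :=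
  splus phi -> forall n s0 s0' v v' (u u' : 'I_k -> unode), sdepth phi <= n ->
  config n s0 s0' v v' u u' ->
  ssat phi (v : unravelling s0) u <-> ssat phi (v' : unravelling s0') u'.

(** A bare state formula is not an admissible path formula, yet X and U take state formulas as
    arguments; the first conjunct carries their invariance through the mutual induction. *)
Definition pform_invariant k (psi : pform AP k) : Prop :=
  (if psi is PState phi then sform_invariant phi else True) /\
  (pplus psi -> forall n s0 s0' f f' (u u' : 'I_k -> unode), pdepth psi <= n ->
   matched n s0 s0' f f' u u' ->
   psat psi (u : _ -> unravelling s0) (Some \o f) 0 <->
   psat psi (u' : _ -> unravelling s0') (Some \o f') 0).

Lemma until_transfer k n s0 s0' f f' (u u' : 'I_k -> unode) (phi1 phi2 : sform AP k) :
  sform_invariant phi1 -> sform_invariant phi2 -> splus phi1 -> splus phi2 ->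
  sdepth phi1 <= n -> sdepth phi2 <= n -> matched n s0 s0' f f' u u' ->
  psat (PU (PState phi1) (PState phi2)) (u : _ -> unravelling s0) (Some \o f) 0 ->
  psat (PU (PState phi1) (PState phi2)) (u' : _ -> unravelling s0') (Some \o f') 0.
Proof.
move=> I1 I2 p1 p2 d1 d2 [M _ _] /= [j [_ _ [_ [[<-] H2]] H1]].
have [j' [C B]] := M j; exists j'; split=> //.
  by exists (f' j'); split=> //; apply/(I2 p2 _ _ _ _ _ _ _ d2 C).
move=> l' lt; have [l lj Cl] := B l' lt; have [_ [[<-] Hl]] := H1 l lj.
by exists (f' l'); split=> //; apply/(I1 p1 _ _ _ _ _ _ _ d1 Cl).
Qed.

Lemma exists_path_transfer k n s0 s0' v v' (u u' : 'I_k -> unode) (psi : pform AP k) :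
  pform_invariant psi -> pplus psi -> pdepth psi <= n -> config n.+3 s0 s0' v v' u u' ->
  (exists pi, path_from (v : unravelling s0) pi /\ psat (T := unravelling s0) psi u pi 0) ->
  exists pi, path_from (v' : unravelling s0') pi /\ psat (T := unravelling s0') psi u' pi 0.
Proof.
move=> [_ Ipsi] ppsi dpsi C [_ [/path_fromP [f [fb f0 ->]] H]].
rewrite -f0 in C; have [f' [fb' f'0 M]] := config_branch C fb.
exists (Some \o f'); split; first by apply/path_fromP; exists f'.
exact/(Ipsi ppsi _ _ _ _ _ _ _ dpsi M).
Qed.

Lemma all_paths_transfer k n s0 s0' v v' (u u' : 'I_k -> unode) (psi : pform AP k) :
  pform_invariant psi -> pplus psi -> pdepth psi <= n -> config n.+3 s0 s0' v v' u u' ->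
  (forall pi, path_from (v : unravelling s0) pi -> psat (T := unravelling s0) psi u pi 0) ->
  forall pi, path_from (v' : unravelling s0') pi -> psat (T := unravelling s0') psi u' pi 0.
Proof.
move=> [_ Ipsi] ppsi dpsi C H _ /path_fromP [f' [fb' f'0 ->]].
have C' := config_sym C; rewrite -f'0 in C'.
have [f [fb f0 M]] := config_branch C' fb'.
apply/(Ipsi ppsi _ _ _ _ _ _ _ dpsi M)/H.
by apply/path_fromP; exists f.
Qed.

Lemma config_le k n m s0 s0' v v' (u u' : 'I_k -> unode) : m <= n ->
  config n s0 s0' v v' u u' -> config m s0 s0' v v' u u'.
Proof.
move=> /subnK <-; elim: (n - m) => [//|d IH] [L [G vL uL]].
by apply: IH; exists L; split=> //; apply: goodS.
Qed.

Scheme sform_pform_ind := Induction for sform Sort Prop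
with pform_sform_ind := Induction for pform Sort Prop.

Lemma plus_invariant k (phi : sform AP k) : sform_invariant phi.
Proof.
apply: (@sform_pform_ind AP k (@sform_invariant k) (@pform_invariant k)) => {phi}.
- move=> q _ n s0 s0' v v' u u' _ [L [G vL _]] /=.
  by rewrite (sim_lab (good_state G vL)).
- move=> phi I /= pphi n s0 s0' v v' u u' d C.
  by have H := I pphi n s0 s0' v v' u u' d C; split=> nH /H.
- move=> phi1 I1 phi2 I2 /= /andP [p1 p2] n s0 s0' v v' u u'.
  rewrite geq_max => /andP [d1 d2] C.
  have H1 := I1 p1 _ _ _ _ _ _ _ d1 C; have H2 := I2 p2 _ _ _ _ _ _ _ d2 C.
  by split=> [] [/H1 ?|/H2 ?]; [left|right|left|right].
- move=> phi1 I1 phi2 I2 /= /andP [p1 p2] n s0 s0' v v' u u'.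
  rewrite geq_max => /andP [d1 d2] C.
  have H1 := I1 p1 _ _ _ _ _ _ _ d1 C; have H2 := I2 p2 _ _ _ _ _ _ _ d2 C.
  by split=> [] [/H1 ? /H2].
- move=> psi I /= ppsi n s0 s0' v v' u u' d /(config_le d) C.
  split; first exact: exists_path_transfer I ppsi (leqnn _) C.
  exact: exists_path_transfer I ppsi (leqnn _) (config_sym C).
- move=> psi I /= ppsi n s0 s0' v v' u u' d /(config_le d) C.
  split; first exact: all_paths_transfer I ppsi (leqnn _) C.
  exact: all_paths_transfer I ppsi (leqnn _) (config_sym C).
- move=> i phi I /= pphi n s0 s0' v v' u u' d [L [G vL uL]].
  apply: (I pphi _ _ _ _ _ _ _ d); exists L; split=> // j.
  by rewrite /assign; case: ifP.
(* Equality of nodes means being prefixes of each other, and positions preserve prefixes both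
   ways. *)
- move=> i _ n s0 s0' v v' u u' _ [L [G vL uL]] /=.
  have e1 := good_prefix G vL (uL i); have e2 := good_prefix G (uL i) vL.
  move: e1 e2 => /= e1 e2.
  by split=> e; apply: prefix_anti; [rewrite -e1|rewrite -e2|rewrite e1|rewrite e2];
     rewrite e prefix_refl.
- move=> i phi I /= pphi n s0 s0' v v' u u' d [L [G vL uL]].
  by apply: (I pphi _ _ _ _ _ _ _ d); exists L; split.
- move=> _ n s0 s0' v v' u u' _ [L [G vL uL]] /=.
  have /= := good_prefix G vL (good_root G).
  by case: v {vL} => [|? ?]; case: v' => [|? ?].
- move=> phi I /= pphi n s0 s0' v v' u u' d [L [G vL uL]].
  by apply: (I pphi _ _ _ _ _ _ _ d); exists L; split=> //; apply: good_root G.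
- by move=> phi I; split.
- move=> psi [_ I]; split=> //= ppsi n s0 s0' f f' u u' d M.
  by have H := I ppsi _ _ _ _ _ _ _ d M; split=> nH /H.
- move=> psi1 [_ I1] psi2 [_ I2]; split=> //= /andP [p1 p2] n s0 s0' f f' u u'.
  rewrite geq_max => /andP [d1 d2] M.
  have H1 := I1 p1 _ _ _ _ _ _ _ d1 M; have H2 := I2 p2 _ _ _ _ _ _ _ d2 M.
  by split=> [] [/H1 ?|/H2 ?]; [left|right|left|right].
- move=> psi1 [_ I1] psi2 [_ I2]; split=> //= /andP [p1 p2] n s0 s0' f f' u u'.
  rewrite geq_max => /andP [d1 d2] M.
  have H1 := I1 p1 _ _ _ _ _ _ _ d1 M; have H2 := I2 p2 _ _ _ _ _ _ _ d2 M.
  by split=> [] [/H1 ? /H2].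
- move=> [phi|?|? ?|? ?|?|? ?] [I _]; split=> //= pphi n s0 s0' f f' u u' d [_ _ C].
  split=> -[_ [w [[<-] H]]]; split=> //; [exists (f' 1)|exists (f 1)]; split=> //.
    exact/(I pphi _ _ _ _ _ _ _ d C).
  exact/(I pphi _ _ _ _ _ _ _ d C).
move=> [phi1|?|? ?|? ?|?|? ?] [I1 _] [phi2|?|? ?|? ?|?|? ?] [I2 _]; split=> //.
move=> /= /andP [p1 p2] n s0 s0' f f' u u'; rewrite geq_max => /andP [d1 d2] M.
split; first exact: (until_transfer I1 I2 p1 p2 d1 d2 M).
exact: (until_transfer I1 I2 p1 p2 d1 d2 (matched_sym M)).
Qed.

Lemma root_equivalence k (phi : sform AP k) s0 s0' :
  splus phi -> sim (sdepth phi) s0 s0' ->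
  ssat phi (Defs.root (unravelling s0)) (fun=> Defs.root (unravelling s0)) <->
  ssat phi (Defs.root (unravelling s0')) (fun=> Defs.root (unravelling s0')).
Proof.
move=> pphi ss; apply: (plus_invariant pphi (leqnn _)).
by exists [:: ([::], [::])]; split; [apply: good_nil|..]; rewrite ?mem_head // => i; rewrite mem_head.
Qed.

End Logic.
End Game.
End Unravelling.

(** * Finite types of words *)

Section StreamCat.
Variable T : Type.
Implicit Types (x : seq T) (f : nat -> T).

(** The default value of [nth] is the stream letter itself and takes effect exactly past the end of
    [x]. *)
Definition scat (x : seq T) (f : nat -> T) i : T := nth (f (i - size x)) x i.

Lemma mkseqD f i j : mkseq f (i + j) = mkseq f i ++ mkseq (fun k => f (i + k)) j.
Proof. by rewrite /mkseq iotaD map_cat add0n -{2}(addn0 i) iotaDl -map_comp. Qed.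

Lemma scat_low x f (x0 : T) i : i < size x -> scat x f i = nth x0 x i.
Proof. by move=> lt; apply: set_nth_default. Qed.

Lemma scat_high x f i : scat x f (size x + i) = f i.
Proof. by rewrite /scat nth_default ?leq_addr // addKn. Qed.

Lemma scat1S (a : T) f i : scat [:: a] f i.+1 = f i.
Proof. exact: (scat_high [:: a] f i). Qed.

Lemma mkseq_scat x f i : mkseq (scat x f) (size x + i) = x ++ mkseq f i.
Proof.
rewrite mkseqD; congr (_ ++ _).
  case: x => [|a x] //; apply: (@eq_from_nth _ a); rewrite size_mkseq // => j lt.
  by rewrite nth_mkseq // (scat_low f a).
by apply: eq_map => j /=; rewrite scat_high.
Qed.

Lemma scat_mkseq f e : f =1 scat (mkseq f e) (fun i => f (e + i)).
Proof.
move=> i; case: (ltnP i e) => lt.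
  by rewrite (scat_low _ (f 0)) ?size_mkseq // nth_mkseq.
rewrite -(subnKC lt); move: (i - e) => k.
by have := scat_high (mkseq f e) (fun i => f (e + i)) k; rewrite size_mkseq => ->.
Qed.

Lemma scat_cons a x f i : scat (a :: x) f i.+1 = scat x f i.
Proof. by []. Qed.

End StreamCat.

Lemma scat_comp (T U : Type) (k : T -> U) (x : seq T) (f : nat -> T) : k \o scat x f =1 scat (map k x) (k \o f).
Proof.
move=> i /=; case: (ltnP i (size x)) => lt.
  by rewrite (scat_low _ (k (f 0))) ?size_map // (scat_low f (f 0)) // (nth_map (f 0)).
rewrite -(subnKC lt); move: (i - size x) => m.
by rewrite scat_high; have := scat_high (map k x) (k \o f) m; rewrite size_map => ->.
Qed.


(** * Types and profiles of words over a finite alphabet *)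

Section WordTypes.
Variable G : finType.
Implicit Types (g : G) (w x y z : seq G) (f : nat -> G).

(** The analogue of Hintikka formulas: a type records which splittings at a letter are possible, up
    to types with one round less. Finiteness is built in. *)
Fixpoint wtype n : finType := if n is m.+1 then {set wtype m * G * wtype m} else bool.

Fixpoint wtp n w : wtype n :=
  match n return wtype n with
  | 0 => nilp w
  | m.+1 => [set t | [exists i : 'I_(size w),
      t == (wtp m (take i w), tnth (in_tuple w) i, wtp m (drop i.+1 w))]]
  end.

Lemma ord_splitP w (Q : seq G -> G -> seq G -> Prop) :
  (exists i : 'I_(size w), Q (take i w) (tnth (in_tuple w) i) (drop i.+1 w)) <->
  (exists y g z, w = y ++ g :: z /\ Q y g z).
Proof.
split=> [[i H]|[y [g [z [ew H]]]]].
  exists (take i w), (tnth (in_tuple w) i), (drop i.+1 w); split=> //.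
  by rewrite (tnth_nth (tnth (in_tuple w) i)) /= -drop_nth ?cat_take_drop.
have lt : size y < size w by rewrite ew size_cat /= addnS ltnS leq_addr.
exists (Ordinal lt) => /=; rewrite (tnth_nth g) /= ew take_size_cat // nth_cat ltnn subnn /=.
by rewrite -cat_rcons drop_size_cat ?size_rcons.
Qed.

Lemma wtpSP n w t : reflect
  (exists y g z, w = y ++ g :: z /\ t = (wtp n y, g, wtp n z)) (t \in wtp n.+1 w).
Proof.
rewrite /= inE; apply: (iffP existsP) => [[i /eqP H]|H].
  by apply/(ord_splitP w (fun y g z => t = (wtp n y, g, wtp n z))); exists i.
have /(ord_splitP w (fun y g z => t = (wtp n y, g, wtp n z))) [i ->] := H.
by exists i.
Qed.

Lemma wtpP n w w' : wtp n w = wtp n w' <-> word_game eq n w w'.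
Proof.
elim: n w w' => [|n IH] w w' //; split=> [e|[H1 H2]].
  have sub v v' : wtp n.+1 v = wtp n.+1 v' -> forall y g z, v = y ++ g :: z ->
      exists y' g' z', [/\ v' = y' ++ g' :: z', word_game eq n y y', g = g' & word_game eq n z z'].
    move=> ev y g z evz; have : (wtp n y, g, wtp n z) \in wtp n.+1 v by apply/wtpSP; exists y, g, z.
    rewrite ev => /wtpSP [y' [g' [z' [-> [ey eg ez]]]]].
    by exists y', g', z'; split=> //; apply/IH.
  split; first exact: sub.
  move=> y' g' z' /(sub _ _ (esym e)) [y [g [z [ew Ey eg Ez]]]].
  by exists y, g, z; split=> //; apply: word_game_sym.
apply/setP => t; apply/wtpSP/wtpSP => -[y [g [z [ew ->]]]].
  have [y' [g' [z' [ew' /IH -> -> /IH ->]]]] := H1 _ _ _ ew.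
  by exists y', g', z'.
have [y' [g' [z' [ew' /IH <- <- /IH <-]]]] := H2 _ _ _ ew.
by exists y', g', z'.
Qed.

Lemma wtp_cat n x x' y y' :
  wtp n x = wtp n x' -> wtp n y = wtp n y' -> wtp n (x ++ y) = wtp n (x' ++ y').
Proof. by move=> /wtpP Hx /wtpP Hy; apply/wtpP/word_game_cat. Qed.

Lemma nseq_split g a y g' z : nseq a g = y ++ g' :: z ->
  [/\ y = nseq (size y) g, g' = g, z = nseq (size z) g & a = size y + (size z).+1].
Proof.
move=> e.
have sa : a = size y + (size z).+1 by rewrite -(size_nseq a g) e size_cat.
have : all (pred1 g) (y ++ g' :: z) by rewrite -e all_pred1_nseq.
rewrite all_cat /= => /and3P [/all_pred1P ey /eqP eg /all_pred1P ez].
by split.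
Qed.

(** A chosen letter splits the block in two. A side shorter than 3^n is copied exactly, a longer one
    is answered by any side of at least 3^n letters; a block of 3^(n+1) letters has room for
    this. *)
Lemma wtp_nseq n g a b : 3 ^ n <= a -> 3 ^ n <= b -> wtp n (nseq a g) = wtp n (nseq b g).
Proof.
elim: n a b => [|n IH] a b; first by case: a; case: b.
rewrite expnS => ha hb.
have K : 0 < 3 ^ n by rewrite expn_gt0.
have half i j c : 3 * 3 ^ n <= i + j.+1 -> 3 * 3 ^ n <= c ->
    exists i' j', [/\ c = i' + j'.+1, wtp n (nseq i g) = wtp n (nseq i' g)
                   & wtp n (nseq j g) = wtp n (nseq j' g)].
  move=> hij hc.
  case: (ltnP i (3 ^ n)) => hi.
    by exists i, (c - i.+1); split=> //; [lia|apply: IH; lia].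
  case: (ltnP j (3 ^ n)) => hj.
    by exists (c - j.+1), j; split=> //; [lia|apply: IH; lia].
  by exists (3 ^ n), (c - (3 ^ n).+1); split; [lia|apply: IH|apply: IH; lia].
have sub c1 c2 : 3 * 3 ^ n <= c1 -> 3 * 3 ^ n <= c2 ->
    forall t, t \in wtp n.+1 (nseq c1 g) -> t \in wtp n.+1 (nseq c2 g).
  move=> h1 h2 t /wtpSP [y [g' [z [/nseq_split [ey -> ez ec] ->]]]].
  have [|i' [j' [e E1 E2]]] := half (size y) (size z) c2 _ h2; first by rewrite -ec.
  apply/wtpSP; exists (nseq i' g), g, (nseq j' g); rewrite ey ez E1 E2; split=> //.
  by rewrite e nseqD.
by apply/setP => t; apply/idP/idP; apply: sub.
Qed.

Variable n : nat.

Definition seen w : {set wtype n * G} :=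
  [set t | [exists i : 'I_(size w), t == (wtp n (take i w), tnth (in_tuple w) i)]].

Lemma seenP w t :
  reflect (exists y g z, w = y ++ g :: z /\ t = (wtp n y, g)) (t \in seen w).
Proof.
rewrite inE; apply: (iffP existsP) => [[i /eqP H]|H].
  by apply/(ord_splitP w (fun y g z => t = (wtp n y, g))); exists i.
have /(ord_splitP w (fun y g z => t = (wtp n y, g))) [i ->] := H.
by exists i.
Qed.

Lemma seen_catP x y t : t \in seen (x ++ y) <->
  t \in seen x \/ exists y1 g y2, y = y1 ++ g :: y2 /\ t = (wtp n (x ++ y1), g).
Proof.
split.
  move=> /seenP [u [g [v [exy ->]]]].
  have [[v1 e _]|[u1 e ->]] := cat_split exy; [left|right; exists u1, g, v => //].
  by apply/seenP; exists u, g, v1.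
case=> [/seenP [u [g [v [-> ->]]]]|[u [g [v [-> ->]]]]].
  by apply/seenP; exists u, g, (v ++ y); rewrite -catA.
by apply/seenP; exists (x ++ u), g, v; rewrite -catA.
Qed.

(** The type is kept beside the seen pairs because it decides which pairs later letters contribute.
    Equality of profiles is a right congruence of finite index. *)
Definition profile w := (wtp n w, seen w).

Lemma profile_cat x x' y : profile x = profile x' -> profile (x ++ y) = profile (x' ++ y).
Proof.
move=> [ex es]; congr pair; first exact: wtp_cat.
have sub z z' t : wtp n z = wtp n z' -> seen z = seen z' ->
    t \in seen (z ++ y) -> t \in seen (z' ++ y).
  move=> ez sz /seen_catP [h|[y1 [g [y2 [ey ->]]]]]; apply/seen_catP; first by left; rewrite -sz.
  by right; exists y1, g, y2; rewrite (wtp_cat (y := y1) ez erefl).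
by apply/setP => t; apply/idP/idP; apply: sub.
Qed.

(* The profile can be computed by a finite automaton; a walk without repetition
   in the product of the graph with this automaton is short. *)
Lemma short_profile (D : finType) (e : rel D) (lbl : D -> G) d (x : seq D) : path e d x ->
  exists x' : seq D, [/\ path e d x', last d x' = last d x,
    profile (map lbl x') = profile (map lbl x)
    & size x' < #|{: (wtype n * {set wtype n * G}) * D}|].
Proof.
move=> px.
pose E (a b : (wtype n * {set wtype n * G}) * D) := e a.2 b.2 &&
  `[< exists w, profile w = a.1 /\ profile (rcons w (lbl b.2)) = b.1 >].
have : connect E (profile [::], d) (profile (map lbl x), last d x).
  elim/last_ind: x px => [|x c IH]; first by rewrite connect0.
  rewrite rcons_path => /andP [/IH {}IH ec]; apply: connect_trans IH _.
  apply: connect1; rewrite /E /= last_rcons ec map_rcons; apply/asboolP.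
  by exists (map lbl x).
case/connectP => P pP; case/shortenP: pP => P' pP' uP' _ lP.
have back w a Q : path E (profile w, a) Q -> exists x' : seq D, [/\ path e a x',
    (profile (w ++ map lbl x'), last a x') = last (profile w, a) Q & size x' = size Q].
  elim: Q w a => [|[q c] Q IH] w a /=; first by exists [::]; rewrite cats0.
  move=> /andP [/andP [/= ac /asboolP [w' [ew eq]]] pQ].
  have eq' : profile (rcons w (lbl c)) = q by rewrite -eq -!cats1; apply: profile_cat.
  rewrite -eq' in pQ *; have [x' [px' <- sx']] := IH _ _ pQ.
  by exists (c :: x'); rewrite /= ac px' cat_rcons sx'.
have [x' [px' ex' sx']] := back [::] d P' pP'.
move: ex'; rewrite -lP /= => -[e1 e2 e3].
exists x'; split=> //; first by rewrite /profile e1 e2.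
rewrite sx'; have := card_uniqP uP' => /= <-; exact: max_card.
Qed.

Definition occurs f t : Prop := exists j, t = (wtp n (mkseq f j), f j).

Definition same_occ f f' : Prop := forall t, occurs f t <-> occurs f' t.

Lemma same_occ_trans f1 f2 f3 : same_occ f1 f2 -> same_occ f2 f3 -> same_occ f1 f3.
Proof. by move=> h1 h2 t; split=> [/h1/h2|/h2/h1]. Qed.

Lemma same_occ_eq f f' : f =1 f' -> same_occ f f'.
Proof.
by move=> e t; split=> -[j ->]; exists j; rewrite -?e ?(eq_mkseq e).
Qed.

Lemma occurs_scat x f t : occurs (scat x f) t <->
  t \in seen x \/ exists j, t = (wtp n (x ++ mkseq f j), f j).
Proof.
have low j : j < size x -> exists g z, x = mkseq (scat x f) j ++ g :: z /\ scat x f j = g.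
  case: x => // a x lt; exists (nth a (a :: x) j), (drop j.+1 (a :: x)).
  rewrite (scat_low f a) // -{1}(cat_take_drop j (a :: x)) (drop_nth a lt); split=> //.
  congr (_ ++ _); apply: (@eq_from_nth _ a).
    by rewrite size_mkseq size_takel // ltnW.
  rewrite size_takel 1?ltnW // => i li; rewrite nth_take // nth_mkseq // (scat_low f a) //.
  exact: ltn_trans li lt.
split=> [[j ->]|[/seenP [y [g [z [ex ->]]]]|[j ->]]].
- case: (ltnP j (size x)) => [/low [g [z [ex ->]]]|/subnKC <-].
    by left; apply/seenP; exists (mkseq (scat x f) j), g, z.
  by right; exists (j - size x); rewrite mkseq_scat scat_high.
- have lt : size y < size x by rewrite ex size_cat /= addnS ltnS leq_addr.
  have [g' [z' [ex' eg']]] := low _ lt.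
  exists (size y); rewrite eg'; move/eqP: ex'; rewrite {1}ex eqseq_cat ?size_mkseq //.
  by move=> /andP [/eqP <- /eqP [->]].
by exists (size x + j); rewrite mkseq_scat scat_high.
Qed.

Lemma same_occ_scat x x' f : profile x = profile x' -> same_occ (scat x f) (scat x' f).
Proof.
move=> [et es] t; split=> /occurs_scat [h|[j ->]]; apply/occurs_scat.
- by left; rewrite -es.
- by right; exists j; rewrite (wtp_cat (y := mkseq f j) et erefl).
- by left; rewrite es.
by right; exists j; rewrite (wtp_cat (y := mkseq f j) et erefl).
Qed.

Lemma mkseq_const g f j : (forall i, i < j -> f i = g) -> mkseq f j = nseq j g.
Proof.
move=> H; apply: (@eq_from_nth _ g); rewrite size_mkseq ?size_nseq // => i lt.
by rewrite nth_mkseq // nth_nseq lt H.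
Qed.

(** In a block of at least 3^n letters [g], one letter more or less does not change the type. Early
    positions keep their index, later ones move by one. *)
Lemma same_occ_shift g f : (forall i, i <= (3 ^ n).+1 -> f i = g) -> same_occ f (f \o succn).
Proof.
move=> H.
have cons j : mkseq f j.+1 = g :: mkseq (f \o succn) j.
  by rewrite -(H 0) // /mkseq /= (iotaDl 1 0) -map_comp.
have short j : j <= 3 ^ n -> (wtp n (mkseq f j), f j) = (wtp n (mkseq (f \o succn) j), (f \o succn) j).
  move=> le; rewrite /= !H ?ltnS ?leqW //.
  rewrite !(@mkseq_const g) // => i lt; last by apply: H; lia.
  by apply: H => /=; lia.
have long j : 3 ^ n <= j -> wtp n (mkseq f j.+1) = wtp n (mkseq (f \o succn) j).
  move=> le; rewrite cons -(subnKC le) mkseqD.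
  rewrite (@mkseq_const g _ (3 ^ n)); last by move=> i lt; apply: H; rewrite ltnS ltnW.
  by rewrite -cat_cons; apply: wtp_cat => //; apply: (@wtp_nseq n g (3 ^ n).+1).
split=> -[j ->].
  case: (leqP j (3 ^ n)) => le; first by exists j; apply: short.
  by case: j le => // j le; exists j; rewrite long.
case: (leqP (3 ^ n) j) => le; first by exists j.+1; rewrite long.
by exists j; rewrite short // ltnW.
Qed.

(** There are finitely many pairs, so finitely many first occurrences to wait for. *)
Lemma occurs_stable f : exists E, forall e, E <= e -> forall t, occurs f t -> t \in seen (mkseq f e).
Proof.
have mono t j e : j < e -> t = (wtp n (mkseq f j), f j) -> t \in seen (mkseq f e).
  move=> lt ->; apply/seenP; exists (mkseq f j), (f j), (mkseq (fun i => f (j.+1 + i)) (e - j.+1)).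
  by rewrite -cat_rcons -mkseqS -mkseqD subnKC.
suff [E HE] : exists E, forall e, E <= e -> forall t, t \in enum {: wtype n * G} -> occurs f t -> t \in seen (mkseq f e).
  by exists E => e le t; apply: HE; rewrite ?mem_enum.
elim: (enum _) => [|t s [E HE]]; first by exists 0.
case: (pselect (occurs f t)) => [[j ej]|no].
  exists (maxn j.+1 E) => e; rewrite geq_max => /andP [l1 l2] t'.
  by rewrite inE => /orP [/eqP -> _|/(HE e l2)] //; apply: mono ej.
by exists E => e le t'; rewrite inE => /orP [/eqP -> //|]; apply: HE.
Qed.

End WordTypes.

Lemma word_game_map (S : Type) (G : finType) (k : S -> G) n x x' :
  word_game eq n (map k x) (map k x') -> word_game (fun s s' => k s = k s') n x x'.
Proof.
have split_map w u g v : map k w = u ++ g :: v ->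
    exists y s z, [/\ w = y ++ s :: z, map k y = u, k s = g & map k z = v].
  elim: w u => [|s w IH] [|a u] //= [].
    by move=> <- <-; exists [::], s, w.
  by move=> <- /IH [y [s' [z [-> <- <- <-]]]]; exists (s :: y), s', z.
elim: n x x' => [|n IH] x x' /=; first by rewrite /nilp !size_map.
move=> [H1 H2]; split=> y s z e.
  have [|u [g [v [/split_map [y' [s' [z' [-> eu eg ev]]]] Hu Hs Hv]]]] := H1 (map k y) (k s) (map k z).
    by rewrite e map_cat.
  by exists y', s', z'; split=> //; [apply: IH; rewrite eu|rewrite Hs|apply: IH; rewrite ev].
have [|u [g [v [/split_map [y' [s' [z' [-> eu eg ev]]]] Hu Hs Hv]]]] := H2 (map k y) (k s) (map k z).
  by rewrite e map_cat.
by exists y', s', z'; split=> //; [apply: IH; rewrite eu|rewrite -Hs|apply: IH; rewrite ev].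
Qed.

(** * The clock *)

Section Clock.
Variables (N h : nat).

(* A state is a rank, the number of further visits to p that are possible, and
   a countdown to the next such visit. At rank [N] the visits are unlimited;
   at rank [0] the countdown runs on idly. *)
Notation cstate := (nat * 'I_h.+1)%type.
Implicit Types (s : cstate) (d : 'I_h.+1) (r n : nat).

Definition tick d d' : bool :=
  if d == 0 :> nat then d' == ord_max else (d' == d) || (d'.+1 == d :> nat).

(** At countdown 0 the rank must drop, except at 0 and [N] where it may stay. A drop of any size is
    allowed, which lets a walk of high rank join one of low rank. *)
Definition cstep s s' : bool :=
  tick s.2 s'.2 &&
  (if s.2 == 0 :> nat
   then (s'.1 < s.1) || (s'.1 == s.1) && ((s.1 == 0) || (s.1 == N))
   else s'.1 == s.1).

Definition cnext s : cstate :=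
  if s.2 == 0 :> nat then (s.1.-1, ord_max) else s.

Definition clabel s : bool := (s.2 == 0 :> nat) && (0 < s.1).

Lemma cstep_next s : cstep s (cnext s).
Proof.
case: s => r d; rewrite /cstep /cnext /tick /=; case: ifP => [->|->] /=; last by rewrite !eqxx.
by rewrite eqxx; case: r => //= r; rewrite ltnSn.
Qed.

Lemma cstep_rank s s' : cstep s s' -> s'.1 <= s.1.
Proof. by move=> /andP [_]; case: ifP => _; lia. Qed.

(** Countdowns from this threshold on look alike at level [n]. Since a step lowers the countdown by
    at most one, the increment guarantees the constant block of [(3 ^ m).+2] letters that
    [same_occ_shift] asks for. *)
Fixpoint near n : nat := if n is m.+1 then near m + (3 ^ m).+2 else 1.

(** The bound of [short_profile] for the alphabet [letter n], written with a parameter [rk] because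
    [letter] is defined from [low], and [low] from this bound. *)
Definition profile_bound (rk n : nat) : nat :=
  #|{: (wtype ('I_rk.+1 * 'I_(near n).+1)%type n *
        {set wtype ('I_rk.+1 * 'I_(near n).+1)%type n * ('I_rk.+1 * 'I_(near n).+1)})
       * 'I_h.+1}|.

(** Ranks from this threshold on look alike at level [n]. A shortened prefix has fewer than
    [profile_bound (low m) m] steps, each costing at most one rank, so started at [low m.+1] it ends
    above [low m]. *)
Fixpoint low n : nat := if n is m.+1 then (low m + profile_bound (low m) m).+1 else 1.

Definition letter n : finType := ('I_(low n).+1 * 'I_(near n).+1)%type.

Definition coarse n s : letter n := (inord (minn s.1 (low n)), inord (minn s.2 (near n))).

Lemma coarseP n r d r' d' : coarse n (r, d) = coarse n (r', d') <->
  minn r (low n) = minn r' (low n) /\ minn d (near n) = minn d' (near n).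
Proof.
rewrite /coarse /=; split=> [[]|[-> ->] //].
move=> /(congr1 val) /= + /(congr1 val) /=.
by rewrite !inordK ?ltnS ?geq_minr // => -> ->.
Qed.

Lemma near_pos n : 0 < near n.
Proof. by elim: n => //= n; lia. Qed.

Lemma low_pos n : 0 < low n.
Proof. by case: n. Qed.

Lemma near_le m n : m <= n -> near m <= near n.
Proof. by move=> /subnK <-; elim: (n - m) => //= k IH; lia. Qed.

Lemma coarse_label n s s' : coarse n s = coarse n s' -> clabel s = clabel s'.
Proof.
case: s s' => [r d] [r' d'] /coarseP; rewrite /clabel /=.
by have := near_pos n; have := low_pos n; lia.
Qed.

Lemma coarseS n s s' : coarse n.+1 s = coarse n.+1 s' -> coarse n s = coarse n s'.
Proof. by case: s s' => [r d] [r' d'] /coarseP H; apply/coarseP; move: H => /=; lia. Qed.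

(** * Simulation between clock states *)

Notation cwalk := (walk cstep).

Definition follows n s s' : Prop := forall f : nat -> cstate, cwalk f -> f 0 = s ->
  exists f' : nat -> cstate, [/\ cwalk f', f' 0 = s' & same_occ n (coarse n \o f \o succn) (coarse n \o f' \o succn)].

Lemma follows_trans n s1 s2 s3 : follows n s1 s2 -> follows n s2 s3 -> follows n s1 s3.
Proof.
move=> H1 H2 f wf f0; have [f' [wf' f'0 e1]] := H1 f wf f0.
have [f2 [wf2 f20 e2]] := H2 f' wf' f'0.
by exists f2; split=> //; apply: same_occ_trans e1 e2.
Qed.

Lemma follows_refl n s : follows n s s.
Proof. by move=> f wf f0; exists f. Qed.

(** The answer ticks once from [d'] to [d] and then copies [f]. The extra letter is absorbed by
    [same_occ_shift], since the countdown stays at least [near n] for long enough. *)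
Lemma follows_up n r d d' : near n.+1 <= d -> d' = d.+1 :> nat -> follows n (r, d) (r, d').
Proof.
move=> le ed f wf f0.
exists (scat [:: (r, d')] f); split.
- case=> [|i]; rewrite !scat1S; last exact: wf.
  by rewrite f0 /cstep /tick /= ed !eqxx orbT.
- by [].
have run i : i <= (3 ^ n).+1 -> (f i).1 = r /\ d <= (f i).2 + i.
  elim: i => [|i IH] lt; first by rewrite f0 addn0.
  have [] := IH (ltnW lt); have := wf i; rewrite /cstep /tick.
  move: le; rewrite /= => le; have := near_pos n.
  by case: ifP => [|_]; [lia|]; move=> ? /andP [/orP [/eqP ->|/eqP e] /eqP ->] ? ?; split=> //; lia.
suff H : same_occ n (coarse n \o f) ((coarse n \o f) \o succn).
  apply: (same_occ_trans (f2 := coarse n \o f)); first by move=> t; split=> /H.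
  apply: same_occ_eq.
  by move=> i; rewrite /= scat1S.
apply: (same_occ_shift (g := coarse n (r, d))) => i lt; have [e1 e2] := run i lt.
rewrite /= [f i]surjective_pairing e1; apply/coarseP; split=> //.
have e3 : near n <= (f i).2.
  rewrite -(leq_add2r i); apply: leq_trans e2; apply: leq_trans le => /=.
  by rewrite leq_add2l leqW.
by rewrite !(minn_idPr _) //; apply: leq_trans le; apply: leq_addr.
Qed.

(** The answer copies [f] but shows [d] while [f] waits at [d']; when [f] ticks to [d], the answer
    pauses. At level [n] the two values look alike. *)
Lemma follows_down n r d d' : near n.+1 <= d -> d' = d.+1 :> nat -> follows n (r, d') (r, d).
Proof.
move=> le ed f wf f0.
pose stay i := all (fun j => (f j).2 == d') (iota 0 i.+1).
have stayS i : stay i.+1 = stay i && ((f i.+1).2 == d').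
  by rewrite /stay -(addn1 i.+1) iotaD all_cat /= add0n andbT.
have stay0 : stay 0 by rewrite /stay /= f0 /= eqxx.
have stay_d i : stay i -> (f i).2 = d' by case: i => [|i]; rewrite ?stayS ?f0 // => /andP [_ /eqP].
have dpos := near_pos n; have dn : near n <= d by move: le => /=; lia.
exists (fun i => ((f i).1, if stay i then d else (f i).2)); split.
- move=> i; have := wf i; rewrite stayS /cstep /tick /=.
  case: (boolP (stay i)) => //= /stay_d ->; rewrite ed /=.
  have -> : (d == 0 :> nat) = false by lia.
  by case: eqP => [-> /andP [_ ->]|_ /andP [/orP [/eqP //|/eqP [e]] ->]]; rewrite ?eqxx // (val_inj e) eqxx.
- by rewrite stay0 f0.
apply: same_occ_eq => i /=; rewrite [f i.+1 in LHS]surjective_pairing.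
by apply/coarseP; case: ifP => // /stay_d ->; rewrite ed; split=> //; lia.
Qed.

Lemma follows_far n r d d' : near n.+1 <= d -> near n.+1 <= d' -> follows n (r, d) (r, d').
Proof.
have both (c : 'I_h.+1) k : near n.+1 <= c -> forall e : 'I_h.+1, e = c + k :> nat ->
    follows n (r, c) (r, e) /\ follows n (r, e) (r, c).
  move=> le; elim: k => [|k IH] e ee.
    by have -> : e = c by [apply: val_inj; rewrite /= ee addn0]; split; apply: follows_refl.
  have lt : c + k < h.+1 by have := ltn_ord e; lia.
  have [H1 H2] := IH (Ordinal lt) erefl.
  have ne : near n.+1 <= Ordinal lt by rewrite (leq_trans le) //= leq_addr.
  have ed : e = (Ordinal lt).+1 :> nat by rewrite ee addnS.
  split; first exact: (follows_trans H1 (follows_up ne ed)).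
  exact: (follows_trans (follows_down ne ed) H2).
move=> l1 l2; case: (leqP d d') => [|/ltnW] le.
  by have [||] := both d (d' - d) _ d'; rewrite ?subnKC.
by have [||] := both d' (d - d') _ d; rewrite ?subnKC.
Qed.

Lemma coarse_high n r d : low n <= r ->
  coarse n (r, d) = (inord (low n), inord (minn d (near n))).
Proof. by move=> le; rewrite /coarse /= (minn_idPr le). Qed.

Lemma cwalk_tick (f : nat -> cstate) i : cwalk f -> tick (f i).2 (f i.+1).2.
Proof. by move=> wf; have /andP [] := wf i. Qed.

Lemma lift_ticks n K r d (x : seq 'I_h.+1) : path tick d x -> low n <= K -> K + size x <= r ->
  exists xs r', [/\ path cstep (r, d) xs, last (r, d) xs = (r', last d x), K <= r'
    & map (coarse n) xs = map (fun c : 'I_h.+1 => (inord (low n), inord (minn c (near n)))) x].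
Proof.
move=> px Kl; elim: x d r px => [|c x IH] d r /=.
  by move=> _; rewrite addn0 => le; exists [::], r.
move=> /andP [dc px] le.
have [|xs [r' [pxs lxs Kr' exs]]] := IH c (if d == 0 :> nat then r.-1 else r) px.
  by case: ifP => _; lia.
exists ((if d == 0 :> nat then r.-1 else r, c) :: xs), r'; split=> //=.
  rewrite pxs andbT /cstep dc /=; case: (_ == _ :> nat); rewrite ?eqxx //.
  by apply/orP; left; lia.
by rewrite exs coarse_high //; case: ifP => _; lia.
Qed.

(** At ranks from [low n] on only the countdown is visible. The prefix is therefore shortened as a
    path of countdowns with the same profile and then given new ranks, starting from [r']. *)
Lemma high_prefix n r r' d (f : nat -> cstate) e : cwalk f -> f 0 = (r, d) ->
  (forall i, i <= e -> low n <= (f i).1) -> low n.+1 <= r' ->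
  exists xs r2, [/\ path cstep (r', d) xs, last (r', d) xs = (r2, (f e).2), low n < r2
    & profile n (map (coarse n) xs) = profile n (mkseq (coarse n \o f \o succn) e)].
Proof.
move=> wf f0 hf hr'.
pose x := mkseq (fun i => (f i.+1).2) e.
have [px lx] : path tick d x /\ last d x = (f e).2.
  rewrite {}/x {hf}; elim: e => [|e [IH1 IH2]]; first by rewrite f0.
  by rewrite mkseqS rcons_path last_rcons IH1 IH2 cwalk_tick.
pose hi (c : 'I_h.+1) : letter n := (inord (low n), inord (minn c (near n))).
have ex : map hi x = mkseq (coarse n \o f \o succn) e.
  rewrite /x -map_comp; apply/eq_in_map => i; rewrite mem_iota /= add0n => lt.
  by rewrite [f i.+1]surjective_pairing coarse_high // hf.
have [x' [px' lx' ex' sx']] := short_profile n hi px.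
have [||xs [r2 [pxs lxs lr2 exs]]] := @lift_ticks n (low n).+1 r' d x' px'.
- exact: leqnSn.
- by apply: leq_trans hr'; rewrite /= addSn ltnS leq_add2l ltnW.
by exists xs, r2; split=> //; [rewrite lxs lx' lx|rewrite exs ex' ex].
Qed.

Lemma cwalk_scat s xs (g : nat -> cstate) : path cstep s xs -> cwalk g ->
  cstep (last s xs) (g 0) -> cwalk (scat (s :: xs) g).
Proof.
move=> pxs wg lg i; case: (ltngtP i (size xs)) => lt.
- rewrite !(scat_low g s) ?ltnS // 1?ltnW //.
  by have /pathP -/(_ s i lt) := pxs.
- have -> : i = size (s :: xs) + (i - (size xs).+1) by rewrite subnKC.
  by rewrite -addnS !scat_high; apply: wg.
rewrite lt (scat_low g s) ?ltnS // -(addn0 (size xs).+1) (scat_high (s :: xs)).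
by rewrite -[size xs]/(size (s :: xs)).-1 nth_last.
Qed.

Lemma splice n s s' xs (f g : nat -> cstate) e : path cstep s xs -> cwalk g ->
  cstep (last s xs) (g 0) ->
  profile n (map (coarse n) xs) = profile n (mkseq (coarse n \o f \o succn) e) ->
  (forall i, coarse n (g i) = coarse n (f (e + i).+1)) -> f 0 = s' ->
  exists f' : nat -> cstate, [/\ cwalk f', f' 0 = s &
    same_occ n (coarse n \o f \o succn) (coarse n \o f' \o succn)].
Proof.
move=> pxs wg lg ep eg f0; exists (scat (s :: xs) g); split=> //; first exact: cwalk_scat.
apply: (same_occ_trans (same_occ_eq (scat_mkseq _ e))).
apply: (same_occ_trans (same_occ_scat _ (esym ep))).
apply: same_occ_eq => i; rewrite /= scat_cons -[RHS]/((coarse n \o scat xs g) i) scat_comp.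
by congr nth; rewrite /= eg.
Qed.

Lemma follows_high n r r' d : near n.+1 <= h -> low n.+1 <= r -> low n.+1 <= r' ->
  follows n (r, d) (r', d).
Proof.
move=> hh lr lr' f wf f0.
have lown : low n < low n.+1 by rewrite /= ltnS leq_addr.
(* First case: [f] falls below [low n]. The prefix before the fall is shortened, and the answer then
   joins [f] itself by one large drop. *)
case: (pselect (exists i, (f i).1 < low n)) => [|nlow].
  move=> ex; case: (ex_minnP ex) => -[|e] fe emin.
    by move: fe; rewrite f0 /= ltnNge (leq_trans (ltnW lown) lr).
  have hf i : i <= e -> low n <= (f i).1.
    by move=> le; rewrite leqNgt; apply/negP => /emin; rewrite ltnNge le.
  have [xs [r2 [pxs lxs lr2 exs]]] := high_prefix wf f0 hf lr'.
  apply: (splice (g := fun i => f (e + i).+1) pxs _ _ exs _ f0) => [i||//].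
    by rewrite addnS; apply: wf.
  rewrite lxs addn0 /cstep /= cwalk_tick //=; have := wf e; rewrite /cstep.
  case: ifP => [_ _|_ /andP [_ /eqP er]].
    by rewrite (ltn_trans fe lr2).
  by have := hf e (leqnn _); rewrite -er leqNgt fe.
have hf i : low n <= (f i).1 by rewrite leqNgt; apply/negP => lt; apply: nlow; exists i.
(* Second case: high ranks and no zero of the countdown from [e] on. After the shortened prefix the
   answer copies the countdowns at constant rank [r2]. *)
case: (pselect (exists e, forall i, e <= i -> (f i).2 != 0 :> nat)) => [[e he]|nzero].
  have [xs [r2 [pxs lxs lr2 exs]]] := high_prefix (e := e) wf f0 (fun i _ => hf i) lr'.
  apply: (splice (g := fun i => (r2, (f (e + i).+1).2)) pxs _ _ exs _ f0) => [i||i].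
  - rewrite /cstep /= addnS cwalk_tick //=.
    by rewrite (negPf (he _ _)) ?eqxx // leqW // leq_addr.
  - by rewrite lxs /cstep /= addn0 cwalk_tick //= (negPf (he _ _)) ?eqxx.
  by rewrite [f _]surjective_pairing !coarse_high //= ltnW.
(* Third case: high ranks and infinitely many zeros. By the time [e], a zero beyond [E], all pairs
   have been seen; the answer shortens the prefix up to [e], reloads the countdown to [h] and pauses
   there forever. *)
have [E HE] := occurs_stable n (coarse n \o f \o succn).
have [e le fe] : exists2 e, E <= e & (f e).2 = 0 :> nat.
  apply: contrapT => no; apply: nzero; exists E => i le.
  by apply/eqP => fi; apply: no; exists i.
have [xs [r2 [pxs lxs lr2 exs]]] := high_prefix (e := e) wf f0 (fun i _ => hf i) lr'.
have hpos : (h == 0) = false by have := near_pos n.+1; lia.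
exists (scat ((r', d) :: xs) (fun=> (r2.-1, ord_max))); split=> //.
  apply: cwalk_scat => // [i|]; first by rewrite /cstep /tick /= hpos !eqxx.
  by rewrite lxs /cstep /tick /= fe !eqxx /=; apply/orP; left; lia.
set y := mkseq _ e in exs.
pose a : letter n := coarse n (r2.-1, ord_max).
(* The walk [f] also reloads right after [e], and [near n.+1 <= h] keeps its countdown at least
   [near n] during these steps. *)
have run i : i <= 3 ^ n -> (coarse n \o f \o succn) (e + i) = a.
  move=> lt; have : h <= (f (e + i).+1).2 + i.
    elim: i lt => [_|i IH lt].
      by have := cwalk_tick e wf; rewrite !addn0 /tick fe eqxx => /eqP ->.
    have := IH (ltnW lt); have := cwalk_tick (e + i).+1 wf; rewrite /tick (addnS e).
    case: ifP => [/eqP -> _|_ /orP [/eqP ->|/eqP <-]].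
    - by move: hh => /=; lia.
    - by move=> ?; rewrite addnS leqW.
    - by rewrite addSn addnS.
  move=> hi; rewrite /= [f _]surjective_pairing /a !coarse_high //; last by lia.
  have e3 : near n <= (f (e + i).+1).2.
    rewrite -(leq_add2r i); apply: leq_trans hi; apply: leq_trans hh => /=.
    by rewrite leq_add2l; lia.
  rewrite !(minn_idPr _) //=; apply: leq_trans hh => /=; exact: leq_addr.
have tail : same_occ n (coarse n \o f \o succn) (scat y (fun=> a)).
  move=> t; split=> [/(HE e le) h1|/occurs_scat [h1|[j ->]]].
  - by apply/occurs_scat; left.
  - by apply/(same_occ_eq (scat_mkseq _ e)); apply/occurs_scat; left.
  apply/(same_occ_eq (scat_mkseq _ e)); apply/occurs_scat; right.
  (* A pause of more than 3^n letters has the type of one of exactly 3^n letters, which [f] shows as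
     well. *)
  exists (minn j (3 ^ n)); rewrite run ?geq_minr //; congr pair.
  apply: wtp_cat => //; rewrite !(@mkseq_const _ a) //; last first.
    by move=> i lt; rewrite run //; lia.
  case: (leqP j (3 ^ n)) => [//|/ltnW lt]; exact: wtp_nseq.
apply: (same_occ_trans tail); apply: (same_occ_trans (same_occ_scat _ (esym exs))).
apply: same_occ_eq => i; rewrite /= scat_cons -[RHS]/((coarse n \o scat xs _) i) scat_comp.
by [].
Qed.

Lemma coarse_follows n s s' : near n.+1 <= h -> coarse n.+1 s = coarse n.+1 s' -> follows n s s'.
Proof.
case: s s' => [r d] [r' d'] hh /coarseP [er ed].
apply: (@follows_trans n _ (r', d)).
  case: (eqVneq r r') => [->|nr]; first exact: follows_refl.
  by apply: follows_high => //; lia.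
case: (eqVneq d d') => [->|nd]; first exact: follows_refl.
by apply: follows_far; move/eqP: nd => nd; have : d <> d' :> nat by [move=> /val_inj]; lia.
Qed.

(** The level is capped by [n0] because [h] is fixed, while simulating walks from level [n.+1]
    requires [near n.+1 <= h]. *)
Definition csim n0 n s s' : Prop := n <= n0 /\ coarse n s = coarse n s'.

Lemma csim_walk n0 n s s' (f : nat -> cstate) : near n0 <= h ->
  csim n0 n.+1 s s' -> cwalk f -> f 0 = s ->
  exists f' : nat -> cstate, [/\ cwalk f', f' 0 = s' & same_types (csim n0) n (f \o succn) (f' \o succn)].
Proof.
move=> hh [le e] wf f0.
have [f' [wf' f'0 H]] := coarse_follows (leq_trans (near_le le) hh) e wf f0.
have conv j j' : (wtp n (mkseq (coarse n \o f \o succn) j), (coarse n \o f \o succn) j) =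
    (wtp n (mkseq (coarse n \o f' \o succn) j'), (coarse n \o f' \o succn) j') ->
    word_game (csim n0 n) n (mkseq (f \o succn) j) (mkseq (f' \o succn) j') /\
    csim n0 n ((f \o succn) j) ((f' \o succn) j').
  move=> ej; have /wtpP W := congr1 fst ej; have ce := congr1 snd ej.
  split; last by split; [apply: ltnW|apply: ce].
  apply: (@word_game_mono _ (fun s s' => coarse n s = coarse n s')).
    by move=> ? ? ?; split=> //; apply: ltnW.
  by apply: word_game_map; rewrite -!map_comp.
exists f'; split=> //; split=> [j|j'].
  have /H [j' ej] : occurs (coarse n \o f \o succn)
    (wtp n (mkseq (coarse n \o f \o succn) j), (coarse n \o f \o succn) j) by exists j.
  by exists j'; apply: conv.
have /H [j ej] : occurs (coarse n \o f' \o succn)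
  (wtp n (mkseq (coarse n \o f' \o succn) j'), (coarse n \o f' \o succn) j') by exists j'.
by exists j; apply: conv.
Qed.

(** * Finitely and infinitely many visits to [p] *)

Lemma cwalk_rank (f : nat -> cstate) i : cwalk f -> (f i).1 <= (f 0).1.
Proof.
by move=> wf; elim: i => // i IH; apply: leq_trans IH; apply: cstep_rank (wf i).
Qed.

(** Below rank [N] each visit to [p] forces the rank to drop, and it never rises again; induction on
    the initial rank. *)
Lemma label_stops (f : nat -> cstate) : cwalk f -> (f 0).1 < N ->
  exists B, forall i, B <= i -> ~~ clabel (f i).
Proof.
have [r] := ubnP (f 0).1; elim: r f => // r IH f le wf lt.
case: (pselect (exists i, clabel (f i))) => [[i /andP [fi ri]]|no]; last first.
  by exists 0 => i _; apply/negP => fi; apply: no; exists i.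
have ri' := cwalk_rank i wf.
have lr : (f i.+1).1 < (f i).1.
  by have /andP [_] := wf i; rewrite fi => /orP [//|/andP [_ /orP [/eqP|/eqP]]]; lia.
have wg : cwalk (fun j => f (i.+1 + j)) by move=> j; rewrite addnS; apply: wf.
have [||B HB] := IH _ _ wg; try by rewrite addn0; lia.
exists (i.+1 + B) => j lej; have := HB (j - i.+1).
by rewrite subnKC; [apply|]; lia.
Qed.

Definition countdown s : cstate :=
  (s.1, if s.2 == 0 :> nat then ord_max else inord s.2.-1).

(** The walk at unlimited rank that never pauses; its countdown is 0 once in every [h.+1] steps. *)
Definition cycle i : cstate := iter i countdown (N, ord_max).

Lemma cycle_rank i : (cycle i).1 = N.
Proof. by elim: i. Qed.

Lemma cwalk_cycle : cwalk cycle.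
Proof.
move=> i; rewrite /cstep /tick /= !cycle_rank !eqxx orbT andbT.
have lt := ltn_ord (cycle i).2.
case: ifP => zi; rewrite zi ?eqxx ?orbT //= andbT.
by rewrite inordK; lia.
Qed.

Lemma cycle_recurrent e : exists2 i, e <= i & (cycle i).2 = 0 :> nat.
Proof.
have [m] : exists m, (cycle e).2 = m :> nat by eexists.
elim: m e => [|m IH] e em; first by exists e.
have [|i lt ei] := IH e.+1; last by exists i => //; apply: ltnW.
have lt := ltn_ord (cycle e).2.
by rewrite /= em /= inordK //; lia.
Qed.

Section Infinitely.
Variables (AP : Type) (p : AP).

Notation ctree := (unravelling cstep cnext clabel p).

Lemma cycle_EFinf : 0 < N -> EFinf p (Defs.root (ctree (N, ord_max))).
Proof.
move=> N0; pose f i : seq (cstate * nat) := mkseq (fun j => (cycle j.+1, 0)) i.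
have sf i : state cstep cnext (N, ord_max) (f i) = cycle i.
  elim: i => [//|i IH]; rewrite /f mkseqS state_rcons -/(f i) IH /move /=.
  by rewrite (cwalk_cycle i).
exists (Some \o f); split.
  apply/path_fromP; exists f; split=> // i.
  by exists (cycle i.+1, 0); rewrite /f mkseqS.
move/finite_seqP => [s es].
(* A zero of the countdown that comes late enough gives a node labelled [p] longer than all words in
   the supposed finite enumeration. *)
have [i lt fi] := cycle_recurrent (\max_(w <- s) size w).+1.
have fs : f i \in s.
  have : [set` s]%classic (f i).
    rewrite -es; split; first by exists i.
    by split=> //; rewrite sf /clabel fi cycle_rank.
  by [].
have := leq_bigmax_seq (P := xpredT) (F := fun w : seq (cstate * nat) => size w) _ fs isT.
rewrite size_mkseq.
by rewrite leqNgt lt.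
Qed.

Lemma ranked_not_EFinf r d : r < N -> ~ EFinf p (Defs.root (ctree (r, d))).
Proof.
move=> lt [pi [/path_fromP [f [fb f0 ->]] inf]]; apply: inf.
have wf : cwalk (fun i => state cstep cnext (r, d) (f i)).
  by move=> i; have [l ->] := fb i; rewrite state_rcons (step_move cstep_next).
have [|B HB] := label_stops wf; first by rewrite f0.
apply: sub_finite_set (finite_image f (finite_II B)) => w [[i [<-]] [_ li]].
by exists i => //=; rewrite ltnNge; apply/negP => /HB; rewrite li.
Qed.

End Infinitely.
End Clock.

Theorem theorem2 (AP : Type) (p : AP) :
  ~ exists (k : nat) (phi : sform AP k),
      [/\ 1 <= k, splus phi
        & forall (T : tree AP) (v : T) (u : 'I_k -> T),
            ssat phi v u <-> EFinf p v].
Proof.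
move=> [k [phi [_ pphi H]]].
(* The depth determines [h], and both determine the rank threshold. The roots have ranks [N] and
   [low h n], which are clipped to the same value at level [n], but only the first is unlimited. *)
pose n := sdepth phi; pose h := near n; pose N := (low h n).+1.
have sim0 : @csim h n n (N, ord_max) (low h n, ord_max).
  by split=> //; apply/coarseP; rewrite minnn (minn_idPr (leqnSn _)).
have E := root_equivalence (@cstep_next N h) (sim := @csim h n) (lab := @clabel h)
  (fun m s s' ss => coarse_label (proj2 ss))
  (fun m s s' ss => conj (ltnW (proj1 ss)) (coarseS (proj2 ss)))
  (fun m s s' ss => conj (proj1 ss) (esym (proj2 ss)))
  (fun m s s' f => @csim_walk N h n m s s' f (leqnn _)) p pphi sim0.
apply: (@ranked_not_EFinf N h AP p (low h n) ord_max (ltnSn _)).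
apply/H/E/H; exact: cycle_EFinf.
Qed.
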